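(* Let $A$ be a smooth nonvanishing function of $u$ which is not of the form $a$ or $a(u+b)^{-2}$ with constants $a,b$, and let $\int A$ denote an antiderivative. (i) For $u_t=(A(u)u_x)_x$, every local conservation law of the united potential system $$v^1_x=u,\quad v^1_t=Au_x,\quad v^2_x=xu,\quad v^2_t=xAu_x-\textstyle\int A$$ (unknowns $u,v^1,v^2$) is trivial. (ii) For $u_t=(A(u)u_x)_x+A(u)u_x$ and $\varepsilon\in\{0,\pm1\}$, every local conservation law of the united potential system $$v^1_x=u,\quad v^1_t=Au_x+\textstyle\int A,\quad v^3_x=(e^x+\varepsilon)u,\quad v^3_t=(e^x+\varepsilon)Au_x+\varepsilon\int A$$ (unknowns $u,v^1,v^3$) is trivial.
   Context: A local conservation law of a system $\mathcal S$ in independent variables $(t,x)$ is an equation $D_tF+D_xG=0$ holding on all solutions of $\mathcal S$, with $(F,G)$ smooth functions of $t,x$ and finitely many derivatives of the unknowns. It is trivial if $F=\hat F+D_xH$, $G=\hat G-D_tH$, where $\hat F,\hat G$ vanish on the solution set of $\mathcal S$ (with its differential consequences) and $H$ is a smooth function of $t,x$ and finitely many derivatives of the unknowns. (The excluded values of $A$ correspond, modulo the equivalence group of the class $u_t=(A(u)u_x)_x+B(u)u_x$, to the linearizable equations; the paper states the theorem for the nonlinearizable equations.) *)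

(* Defs.v *)
From Stdlib Require Import Reals List.
From Coquelicot Require Import Coquelicot.
Import ListNotations.
Open Scope R_scope.

(* Coordinates of the (infinite) jet space: t, x, and
   [Cu k i j] = d_t^i d_x^j of the k-th unknown. *)
Inductive coord : Type := Ct | Cx | Cu (k i j : nat).

Definition coord_eq_dec : forall c d : coord, {c = d} + {c <> d}.
Proof. decide equality; apply Nat.eq_dec. Defined.

Definition jet := coord -> R.

Definition upd (z : jet) (c : coord) (s : R) : jet :=
  fun d => if coord_eq_dec c d then s else z d.

Definition relevant (m N : nat) (c : coord) : Prop :=
  match c with
  | Ct | Cx => True
  | Cu k i j => (k < m)%nat /\ (i + j <= N)%nat
  end.

Definition depends_on (m N : nat) (F : jet -> R) : Prop :=
  forall z w, (forall c, relevant m N c -> z c = w c) -> F z = F w.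

Definition pd (c : coord) (F : jet -> R) : jet -> R :=
  fun z => Derive (fun s => F (upd z c s)) (z c).

Definition iter_pd (l : list coord) (F : jet -> R) : jet -> R :=
  fold_right pd F l.

Definition cont_at (m N : nat) (Om : jet -> Prop) (f : jet -> R) (z : jet) : Prop :=
  forall eps, 0 < eps -> exists delta, 0 < delta /\
    forall w, Om w -> (forall c, relevant m N c -> Rabs (w c - z c) < delta) ->
      Rabs (f w - f z) < eps.

Definition smooth_on (m N : nat) (Om : jet -> Prop) (F : jet -> R) : Prop :=
  forall (l : list coord) (z : jet), Om z ->
    (forall c, ex_derive (fun s => iter_pd l F (upd z c s)) (z c)) /\
    cont_at m N Om (iter_pd l F) z.

Definition difffun (m : nat) (Om : jet -> Prop) (F : jet -> R) : Prop :=
  exists N, depends_on m N F /\ smooth_on m N Om F.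

Fixpoint sumR (n : nat) (f : nat -> R) : R :=
  match n with O => 0 | S n => sumR n f + f n end.

(* total derivatives, for a function depending on derivatives of order <= N *)
Definition Dx (m N : nat) (F : jet -> R) : jet -> R := fun z =>
  pd Cx F z + sumR m (fun k => sumR (S N) (fun i => sumR (S N) (fun j =>
     z (Cu k i (S j)) * pd (Cu k i j) F z))).

Definition Dt (m N : nat) (F : jet -> R) : jet -> R := fun z =>
  pd Ct F z + sumR m (fun k => sumR (S N) (fun i => sumR (S N) (fun j =>
     z (Cu k (S i) j) * pd (Cu k i j) F z))).

Fixpoint Dxs (m q N : nat) (F : jet -> R) : jet -> R :=
  match q with O => F | S q => Dx m (N + q) (Dxs m q N F) end.
Fixpoint Dts (m p N : nat) (F : jet -> R) : jet -> R :=
  match p with O => F | S p => Dt m (N + p) (Dts m p N F) end.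

(* The solution set in jet space of the system E (equations E = 0, all of
   order <= NE) together with all its differential consequences, inside Om. *)
Definition sol_set (m : nat) (Om : jet -> Prop) (E : list (jet -> R)) (NE : nat)
  (z : jet) : Prop :=
  Om z /\ forall e p q, In e E -> Dts m p (NE + q) (Dxs m q NE e) z = 0.

Definition conservation_law (m : nat) (Om : jet -> Prop) (E : list (jet -> R))
  (NE : nat) (F G : jet -> R) : Prop :=
  difffun m Om F /\ difffun m Om G /\
  exists N, depends_on m N F /\ depends_on m N G /\
    forall z, sol_set m Om E NE z -> Dt m N F z + Dx m N G z = 0.

Definition trivial_cl (m : nat) (Om : jet -> Prop) (E : list (jet -> R))
  (NE : nat) (F G : jet -> R) : Prop :=
  exists N (Fh Gh H : jet -> R),
    difffun m Om Fh /\ difffun m Om Gh /\ difffun m Om H /\ depends_on m N H /\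
    (forall z, sol_set m Om E NE z -> Fh z = 0 /\ Gh z = 0) /\
    forall z, Om z -> F z = Fh z + Dx m N H z /\ G z = Gh z - Dt m N H z.

Definition is_open_interval (U : R -> Prop) : Prop :=
  (exists y, U y) /\
  (forall y, U y -> exists r, 0 < r /\ forall w, Rabs (w - y) < r -> U w) /\
  (forall x y w, U x -> U y -> x <= w <= y -> U w).

Definition u_dom (U : R -> Prop) : jet -> Prop := fun z => U (z (Cu 0 0 0)).

(* unknowns: 0 = u, 1 = v^1, 2 = v^2 ; B is an antiderivative of A *)
Definition sys1 (A B : R -> R) : list (jet -> R) :=
  [ (fun z => z (Cu 1 0 1) - z (Cu 0 0 0));
    (fun z => z (Cu 1 1 0) - A (z (Cu 0 0 0)) * z (Cu 0 0 1));
    (fun z => z (Cu 2 0 1) - z Cx * z (Cu 0 0 0));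
    (fun z => z (Cu 2 1 0) - (z Cx * A (z (Cu 0 0 0)) * z (Cu 0 0 1)
                              - B (z (Cu 0 0 0)))) ].

(* unknowns: 0 = u, 1 = v^1, 2 = v^3 *)
Definition sys2 (A B : R -> R) (eps : R) : list (jet -> R) :=
  [ (fun z => z (Cu 1 0 1) - z (Cu 0 0 0));
    (fun z => z (Cu 1 1 0) - (A (z (Cu 0 0 0)) * z (Cu 0 0 1) + B (z (Cu 0 0 0))));
    (fun z => z (Cu 2 0 1) - (exp (z Cx) + eps) * z (Cu 0 0 0));
    (fun z => z (Cu 2 1 0) - ((exp (z Cx) + eps) * A (z (Cu 0 0 0)) * z (Cu 0 0 1)
                              + eps * B (z (Cu 0 0 0)))) ].

(* Main.v *)
(* Both systems are instances of
     v^1_x = u,       v^1_t = A u_x + b int A,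
     v^2_x = phi u,   v^2_t = phi A u_x + c int A,     phi' = b phi - c <> 0.
   On the solution set use the coordinates t, x, s_0 = v^2 - phi v^1, s_1 = v^1 and
   s_{k+2} = d_x^k u.  There D_x s_0 = - phi' s_1 and D_x s_{k+1} = s_{k+2}, so that D_x
   acts like the total derivative of a single potential s_0, and D_t commutes with D_x.
   Let D_t F + D_x G = 0 with F of order n in the s_k.  Differentiating the equation
   with respect to the highest coordinates shows that G has order n + 1,
   G_{s_{n+1}} = - A F_{s_n}, and, for n >= 2, F_{s_n s_n} = 0.  For n <= 1 the equation
   is a relation between 1, u, int A and u int A, which are linearly independent
   exactly because A is neither constant nor a (u + b)^(-2); this gives
   F_{s_1 s_1} = 0, and F_{s_0} = 0 when n = 0.  As F is affine in s_n, subtracting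
   D_x H with H an antiderivative in s_{n-1} lowers the order, until F depends
   on t, x only, where it is D_x of its antiderivative in x. *)
Require Import Defs.
From Stdlib Require Import Reals List.
From Coquelicot Require Import Coquelicot.
From Stdlib Require Import Lra Lia Classical ClassicalEpsilon FunctionalExtensionality FinFun.
Import Defs.
Import ListNotations.
Open Scope R_scope.

(** The relation phi' = b phi - c is the compatibility of the two equations for v^2, given those for
    v^1. It also cancels u_x in D_t s_0 = - phi' int A, so s_0 obeys a closed evolution equation,
    and phi' <> 0 recovers s_1 from D_x s_0. For n >= 2 the quasilinear term does no harm: the
    derivatives of A arising from D_t F and from D_x G cancel. For n = 1 the direction s_{n+1} is u
    itself, on which A depends, so the relation between 1, u, int A and u int A must take over.
    Smoothness is given as iterated partial derivatives, each jointly continuous in finitely many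
    coordinates, and only where u lies in U. The chain rule, symmetry of second derivatives and
    smoothness of primitives are derived from this, and identities are asserted over that domain
    only. Restricted functions live on the same jet type as the original ones. Two maps, [sigma]
    from restricted coordinates to solution jets and [tau] back, turn a potential H found on the
    solution set into a function on the whole jet space. *)

Lemma upd_same z c s : upd z c s c = s.
Proof. unfold upd; destruct (coord_eq_dec c c); congruence. Qed.

Lemma upd_other z c s d : d <> c -> upd z c s d = z d.
Proof. unfold upd; destruct (coord_eq_dec c d); congruence. Qed.

Lemma upd_upd z c s t : upd (upd z c s) c t = upd z c t.
Proof.
  extensionality d; unfold upd; destruct (coord_eq_dec c d); reflexivity.
Qed.

Lemma upd_id z c : upd z c (z c) = z.
Proof.
  extensionality d; unfold upd; destruct (coord_eq_dec c d); congruence.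
Qed.

Lemma upd_comm z c d s t : c <> d -> upd (upd z c s) d t = upd (upd z d t) c s.
Proof.
  intros H; extensionality e; unfold upd.
  destruct (coord_eq_dec d e), (coord_eq_dec c e); congruence.
Qed.

(** * Dependence on a set of coordinates *)

Definition dep (S : coord -> Prop) (f : jet -> R) : Prop :=
  forall z w, (forall c, S c -> z c = w c) -> f z = f w.

Lemma dep_mono (S S' : coord -> Prop) f :
  (forall c, S c -> S' c) -> dep S f -> dep S' f.
Proof. intros H Hf z w E; apply Hf; auto. Qed.

Lemma dep_upd S f z c s : dep S f -> ~ S c -> f (upd z c s) = f z.
Proof.
  intros Hf Hc; apply Hf; intros d Hd; apply upd_other; intros ->; tauto.
Qed.

Lemma dep_pd_zero S f c z : dep S f -> ~ S c -> pd c f z = 0.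
Proof.
  intros Hf Hc; unfold pd.
  rewrite (Derive_ext _ (fun _ => f z)); [apply Derive_const|].
  intros t; now apply (dep_upd S).
Qed.

Lemma dep_pd S f c : dep S f -> dep S (pd c f).
Proof.
  intros Hf z w E.
  destruct (classic (S c)) as [Hc|Hc].
  - unfold pd; rewrite (E c Hc); apply Derive_ext; intros t.
    apply Hf; intros d Hd; unfold upd; destruct (coord_eq_dec c d); auto.
  - now rewrite !(dep_pd_zero S).
Qed.

(** * Finite sums over coordinates *)

Definition lsum {X} (l : list X) (f : X -> R) : R :=
  fold_right (fun c a => f c + a) 0 l.

Lemma lsum_ext {X} (l : list X) (f g : X -> R) :
  (forall c, In c l -> f c = g c) -> lsum l f = lsum l g.
Proof.
  induction l as [|c l IH]; simpl; intros H; [reflexivity|].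
  rewrite (H c), IH; auto.
Qed.

Lemma lsum_zero {X} (l : list X) (f : X -> R) :
  (forall c, In c l -> f c = 0) -> lsum l f = 0.
Proof.
  induction l as [|c l IH]; simpl; intros H; [reflexivity|].
  rewrite (H c), IH; auto; ring.
Qed.

Lemma lsum_plus {X} (l : list X) (f g : X -> R) :
  lsum l (fun c => f c + g c) = lsum l f + lsum l g.
Proof. induction l as [|c l IH]; simpl; [ring|rewrite IH; ring]. Qed.

Lemma lsum_scal {X} l k (f : X -> R) : lsum l (fun c => k * f c) = k * lsum l f.
Proof. induction l as [|c l IH]; simpl; [ring|rewrite IH; ring]. Qed.

Lemma lsum_swap {X Y} (l : list X) (l' : list Y) f :
  lsum l (fun c => lsum l' (f c)) = lsum l' (fun d => lsum l (fun c => f c d)).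
Proof.
  induction l as [|c l IH]; simpl.
  - symmetry; apply lsum_zero; reflexivity.
  - now rewrite lsum_plus, IH.
Qed.

Lemma lsum_app {X} l l' (f : X -> R) : lsum (l ++ l') f = lsum l f + lsum l' f.
Proof. induction l as [|c l IH]; simpl; [ring|rewrite IH; ring]. Qed.

Lemma lsum_map {X Y} (g : X -> Y) l f : lsum (map g l) f = lsum l (fun x => f (g x)).
Proof. induction l as [|x l IH]; simpl; [|rewrite IH]; reflexivity. Qed.

Lemma lsum_prod {X Y} (l : list X) (l' : list Y) f :
  lsum (list_prod l l') f = lsum l (fun x => lsum l' (fun y => f (x, y))).
Proof.
  induction l as [|x l IH]; simpl; [reflexivity|].
  now rewrite lsum_app, lsum_map, IH.
Qed.

Lemma lsum_seq n f : lsum (seq 0 n) f = sumR n f.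
Proof.
  induction n as [|n IH]; [reflexivity|].
  rewrite seq_S, lsum_app, IH; simpl; ring.
Qed.

Lemma lsum_pick l (f : coord -> R) c : NoDup l -> In c l ->
  lsum l f = f c + lsum (remove coord_eq_dec c l) f.
Proof.
  induction l as [|d l IH]; simpl; [tauto|intros Hn Hc].
  inversion Hn as [|? ? Hd Hl]; subst.
  destruct (coord_eq_dec c d) as [->|E].
  - now rewrite notin_remove.
  - destruct Hc as [->|Hc]; [congruence|]; simpl; rewrite IH; auto; ring.
Qed.

Lemma NoDup_remove_dec c l : NoDup l -> NoDup (remove coord_eq_dec c l).
Proof.
  induction l as [|d l IH]; simpl; intros H; [constructor|].
  inversion H; subst.
  destruct (coord_eq_dec c d); auto.
  constructor; auto; intros Hi; apply in_remove in Hi; tauto.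
Qed.

(** Differential operators are sums over a list fixed by an order bound, and different bounds give
    different lists; this makes the choice of bound immaterial. *)
Lemma lsum_support (l l' : list coord) f : NoDup l -> NoDup l' ->
  (forall c, In c l -> ~ In c l' -> f c = 0) ->
  (forall c, In c l' -> ~ In c l -> f c = 0) ->
  lsum l f = lsum l' f.
Proof.
  revert l'; induction l as [|c l IH]; simpl; intros l' Hl Hl' H1 H2.
  - symmetry; apply lsum_zero; auto.
  - inversion Hl as [|? ? Hc Hl1]; subst.
    destruct (in_dec coord_eq_dec c l') as [Hi|Hi].
    + rewrite (lsum_pick l' f c Hl' Hi); f_equal.
      apply IH; auto using NoDup_remove_dec.
      * intros d Hd Hn; apply H1; auto; intros Hd'; apply Hn.
        apply in_in_remove; auto; congruence.
      * intros d Hd Hn; apply in_remove in Hd as [Hd Hdc].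
        apply H2; auto; intros [->|?]; auto.
    + rewrite H1; auto; rewrite Rplus_0_l; apply IH; auto.
      intros d Hd Hn; apply H2; auto; intros [->|?]; auto.
Qed.

Lemma lsum_single (l : list coord) c f : NoDup l -> In c l -> (forall d, d <> c -> f d = 0) ->
  lsum l f = f c.
Proof.
  intros Hl Hc Hf; rewrite (lsum_pick l f c Hl Hc), lsum_zero; [ring|].
  intros d Hd; apply in_remove in Hd; apply Hf; tauto.
Qed.

(** The square i, j <= N rather than the triangle i + j <= N of [relevant], because [Dx] and [Dt]
    sum over exactly this square. *)
Definition coords (m N : nat) : list coord :=
  Ct :: Cx :: map (fun p => Cu (fst p) (fst (snd p)) (snd (snd p)))
    (list_prod (seq 0 m) (list_prod (seq 0 (S N)) (seq 0 (S N)))).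

Lemma In_coords m N k i j :
  In (Cu k i j) (coords m N) <-> (k < m /\ i <= N /\ j <= N)%nat.
Proof.
  unfold coords; cbn [In]; rewrite in_map_iff; split.
  - intros [?|[?|[[k' [i' j']] [E H]]]]; try discriminate.
    injection E as -> -> ->; rewrite !in_prod_iff, !in_seq in H; lia.
  - intros H; right; right; exists (k, (i, j)); split; auto.
    rewrite !in_prod_iff, !in_seq; lia.
Qed.

Lemma relevant_coords m N c : relevant m N c -> In c (coords m N).
Proof.
  destruct c as [| |k i j]; simpl; auto.
  intros H; apply In_coords; lia.
Qed.

Lemma NoDup_prod {X Y} (l : list X) (l' : list Y) :
  NoDup l -> NoDup l' -> NoDup (list_prod l l').
Proof.
  induction l as [|x l IH]; simpl; intros H H'; [constructor|].
  inversion H; subst; apply NoDup_app; auto.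
  - apply Injective_map_NoDup; auto; intros a b E; congruence.
  - intros [a b] Ha Hb; apply in_map_iff in Ha as [y [E _]].
    apply in_prod_iff in Hb; injection E as <- <-; tauto.
Qed.

Lemma NoDup_coords m N : NoDup (coords m N).
Proof.
  unfold coords; repeat constructor.
  - simpl; intros [?|H]; [discriminate|].
    apply in_map_iff in H as [? [? _]]; discriminate.
  - intros H; apply in_map_iff in H as [? [? _]]; discriminate.
  - apply Injective_map_NoDup.
    + intros [? [? ?]] [? [? ?]]; simpl; congruence.
    + auto using NoDup_prod, seq_NoDup.
Qed.

(** * Neighbourhoods in the jet space *)

Lemma locally_forall_in (l : list coord) (t : R) (Q : coord -> R -> Prop) :
  (forall c, In c l -> locally t (Q c)) ->
  locally t (fun s => forall c, In c l -> Q c s).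
Proof.
  induction l as [|c l IH]; intros H.
  - apply filter_forall; simpl; tauto.
  - generalize (filter_and _ _ (H c (or_introl eq_refl))
                 (IH (fun d h => H d (or_intror h)))).
    apply filter_imp; intros s [H1 H2] d [<-|Hd]; auto.
Qed.

Lemma min_delta (l : list coord) (Q : coord -> R -> Prop) :
  (forall c d d', Q c d -> d' <= d -> Q c d') ->
  (forall c, In c l -> exists d, 0 < d /\ Q c d) ->
  exists d, 0 < d /\ forall c, In c l -> Q c d.
Proof.
  intros HQ; induction l as [|c l IH]; intros H.
  - exists 1; split; [lra|simpl; tauto].
  - destruct (H c (or_introl eq_refl)) as [d1 [Hd1 H1]].
    destruct IH as [d2 [Hd2 H2]]; [intros; apply H; simpl; auto|].
    exists (Rmin d1 d2); split; [now apply Rmin_glb_lt|].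
    intros e [<-|He]; eapply HQ; eauto using Rmin_l, Rmin_r.
Qed.

Lemma mul_close (a b eps : R) : 0 < eps ->
  exists d, 0 < d /\ forall x y, Rabs (x - a) < d -> Rabs (y - b) < d ->
    Rabs (x * y - a * b) < eps.
Proof.
  intros He.
  assert (Hp : 0 < Rabs a + Rabs b + 2)
    by (pose proof (Rabs_pos a); pose proof (Rabs_pos b); lra).
  exists (Rmin 1 (eps / (Rabs a + Rabs b + 2))); split.
  { apply Rmin_glb_lt; [lra|now apply Rdiv_lt_0_compat]. }
  intros x y Hx Hy.
  set (d := Rmin 1 (eps / (Rabs a + Rabs b + 2))) in *.
  assert (Hd1 : d <= 1) by apply Rmin_l.
  assert (Hd2 : d * (Rabs a + Rabs b + 2) <= eps).
  { apply Rmult_le_reg_r with (/ (Rabs a + Rabs b + 2)).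
    - now apply Rinv_0_lt_compat.
    - rewrite Rmult_assoc, Rinv_r, Rmult_1_r by lra; apply Rmin_r. }
  replace (x * y - a * b) with ((x - a) * (y - b) + (x - a) * b + a * (y - b))
    by ring.
  eapply Rle_lt_trans; [apply Rabs_triang|].
  eapply Rle_lt_trans; [apply Rplus_le_compat_r, Rabs_triang|].
  rewrite !Rabs_mult.
  pose proof (Rabs_pos a); pose proof (Rabs_pos b).
  pose proof (Rabs_pos (x - a)); pose proof (Rabs_pos (y - b)).
  nra.
Qed.

(** At a zero of h the product p h is differentiable as soon as p tends to q. No regularity of p is
    asked, since p will be a partial derivative at a mean-value point that varies with s without
    control. *)
Lemma is_derive_mul_close (d h : R -> R) (t h' q : R) :
  h t = 0 -> is_derive h t h' -> d t = 0 ->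
  (forall eps, 0 < eps -> locally t (fun s => exists p,
     Rabs (p - q) < eps /\ d s = p * h s)) ->
  is_derive d t (q * h').
Proof.
  intros Hh Hd Hd0 Hq; apply is_derive_Reals in Hd; apply is_derive_Reals.
  intros eps He.
  destruct (mul_close q h' eps He) as [e [He' Hm]].
  destruct (Hd e He') as [d1 H1].
  destruct (Hq e He') as [d2 H2].
  assert (Hpos : 0 < Rmin d1 d2) by (apply Rmin_glb_lt; apply cond_pos).
  exists (mkposreal _ Hpos); simpl; intros s Hs Hsd.
  assert (Hs1 : Rabs s < d1) by (eapply Rlt_le_trans; [exact Hsd|apply Rmin_l]).
  assert (Hs2 : Rabs s < d2) by (eapply Rlt_le_trans; [exact Hsd|apply Rmin_r]).
  specialize (H1 s Hs Hs1).
  destruct (H2 (t + s)) as [p [Hp Ep]].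
  { unfold ball; simpl; unfold AbsRing_ball, abs, minus, plus, opp; simpl.
    now replace (t + s + - t) with s by ring. }
  rewrite Hd0, Ep.
  replace ((p * h (t + s) - 0) / s) with (p * ((h (t + s) - h t) / s))
    by (rewrite Hh; field; auto).
  now apply Hm.
Qed.

(** * Smooth functions on the domain: chain rule and closure properties *)

Section Calculus.

Variables (m : nat) (U : R -> Prop).
Hypothesis HU : is_open_interval U.

Notation Om := (u_dom U).

(** Only u is constrained by [u_dom], so [Om] is a product and can be handled one coordinate at a
    time. *)
Definition dom (c : coord) (y : R) : Prop := c = Cu 0 0 0 -> U y.

Lemma dom_at z c : Om z -> dom c (z c).
Proof. intros Hz ->; exact Hz. Qed.

Lemma Om_upd z c y : Om z -> dom c y -> Om (upd z c y).
Proof.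
  unfold u_dom, dom, upd; intros Hz Hy.
  destruct (coord_eq_dec c (Cu 0 0 0)); auto.
Qed.

Lemma dom_open c y : dom c y ->
  exists r, 0 < r /\ forall w, Rabs (w - y) < r -> dom c w.
Proof.
  intros Hy; destruct (coord_eq_dec c (Cu 0 0 0)) as [E|E].
  - destruct HU as [_ [Ho _]].
    destruct (Ho y (Hy E)) as [r [Hr H]]; exists r; split; auto.
    intros w Hw _; auto.
  - exists 1; split; [lra|]; intros w _ ?; tauto.
Qed.

Lemma dom_conv c x y w : dom c x -> dom c y -> x <= w <= y -> dom c w.
Proof.
  intros Hx Hy Hw E; destruct HU as [_ [_ Hc]]; apply (Hc x y w); auto.
Qed.

Lemma dom_conv_minmax c x y w :
  dom c x -> dom c y -> Rmin x y <= w <= Rmax x y -> dom c w.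
Proof.
  unfold Rmin, Rmax; intros Hx Hy; destruct (Rle_dec x y); intros Hw.
  - now apply (dom_conv c x y).
  - now apply (dom_conv c y x).
Qed.

Lemma dom_locally c y : dom c y -> locally y (dom c).
Proof.
  intros H; destruct (dom_open c y H) as [r [Hr Hd]].
  exists (mkposreal r Hr); intros w Hw; apply Hd, Hw.
Qed.

Lemma iter_pd_ext_on l (f g : jet -> R) z :
  (forall y, Om y -> f y = g y) -> Om z -> iter_pd l f z = iter_pd l g z.
Proof.
  intros E; revert z; induction l as [|c l IH]; intros z Hz; simpl; auto.
  unfold pd; apply Derive_ext_loc.
  generalize (dom_locally c (z c) (dom_at z c Hz)); apply filter_imp.
  intros y Hy; apply IH, Om_upd; auto.
Qed.

Lemma pd_ext_on c (f g : jet -> R) z :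
  (forall y, Om y -> f y = g y) -> Om z -> pd c f z = pd c g z.
Proof. apply (iter_pd_ext_on [c]). Qed.

Lemma cont_at_ext N (f g : jet -> R) z :
  (forall y, Om y -> f y = g y) -> Om z ->
  cont_at m N Om f z -> cont_at m N Om g z.
Proof.
  intros E Hz H eps He; destruct (H eps He) as [d [Hd Hw]].
  exists d; split; auto; intros w Hw1 Hw2; rewrite <- !E; auto.
Qed.

Lemma ex_derive_ext_on c (f g : jet -> R) z :
  (forall y, Om y -> f y = g y) -> Om z ->
  ex_derive (fun s => f (upd z c s)) (z c) ->
  ex_derive (fun s => g (upd z c s)) (z c).
Proof.
  intros E Hz; apply ex_derive_ext_loc.
  generalize (dom_locally c (z c) (dom_at z c Hz)); apply filter_imp.
  intros y Hy; apply E, Om_upd; auto.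
Qed.

Lemma cont_at_mono N N' f z : (N <= N')%nat ->
  cont_at m N Om f z -> cont_at m N' Om f z.
Proof.
  intros HN H eps He; destruct (H eps He) as [d [Hd Hw]].
  exists d; split; auto; intros w Hw1 Hw2; apply Hw; auto.
  intros c Hc; apply Hw2; destruct c; simpl in *; auto; lia.
Qed.

Lemma smooth_on_mono N N' f : (N <= N')%nat ->
  smooth_on m N Om f -> smooth_on m N' Om f.
Proof.
  intros HN H l z Hz; destruct (H l z Hz); split; eauto using cont_at_mono.
Qed.

Lemma depends_on_mono N N' f : (N <= N')%nat ->
  depends_on m N f -> depends_on m N' f.
Proof.
  intros HN; apply dep_mono; intros [| |k i j]; simpl; auto; lia.
Qed.

Lemma smooth_on_pd N c f : smooth_on m N Om f -> smooth_on m N Om (pd c f).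
Proof.
  intros H l z Hz; generalize (H (l ++ [c]) z Hz).
  unfold iter_pd; rewrite fold_right_app; auto.
Qed.

(* Coinduction principle: [smooth_on] is the largest class of regular functions
   stable, up to equality on the domain, under partial derivatives. *)
Lemma smooth_on_coind N (P : (jet -> R) -> Prop) :
  (forall f, P f ->
     (forall z, Om z -> (forall c, ex_derive (fun s => f (upd z c s)) (z c)) /\
                        cont_at m N Om f z) /\
     forall c, exists g, P g /\ forall z, Om z -> pd c f z = g z) ->
  forall f, P f -> smooth_on m N Om f.
Proof.
  intros HP f Hf l.
  assert (E : exists g, P g /\ forall z, Om z -> iter_pd l f z = g z).
  { induction l as [|c l IH]; simpl; [eauto|].
    destruct IH as [g [Hg E]].
    destruct (HP g Hg) as [_ Hc]; destruct (Hc c) as [h [Hh E']].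
    exists h; split; auto; intros z Hz; rewrite <- E'; auto.
    now apply pd_ext_on. }
  destruct E as [g [Hg E]]; intros z Hz.
  assert (E' : forall y, Om y -> g y = iter_pd l f y) by (intros; symmetry; auto).
  destruct (HP g Hg) as [H1 _]; destruct (H1 z Hz) as [H2 H3].
  split; [intros c; apply (ex_derive_ext_on c g)|apply (cont_at_ext N g)]; auto.
Qed.

Lemma smooth_on_derive N f z c y : smooth_on m N Om f -> Om z -> dom c y ->
  is_derive (fun s => f (upd z c s)) y (pd c f (upd z c y)).
Proof.
  intros Hf Hz Hy.
  destruct (Hf [] (upd z c y)) as [H _]; [now apply Om_upd|].
  specialize (H c); simpl in H; rewrite upd_same in H.
  assert (E : forall s, f (upd (upd z c y) c s) = f (upd z c s))
    by (intros; now rewrite upd_upd).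
  unfold pd; rewrite upd_same.
  rewrite (Derive_ext _ (fun s => f (upd z c s))) by exact E.
  apply Derive_correct; eapply ex_derive_ext; [exact E|exact H].
Qed.

(** The coordinates move from [g t] to [g s] one at a time. Each move changes f by a partial
    derivative at an intermediate point times the increment of that coordinate; joint continuity
    sends this factor to its value at [g t], and convexity of [dom] keeps the intermediate points in
    [Om]. *)
Lemma chain_rule N f (g : R -> jet) (t : R) (g' : coord -> R) :
  depends_on m N f -> smooth_on m N Om f ->
  locally t (fun s => Om (g s)) ->
  (forall c, In c (coords m N) -> is_derive (fun s => g s c) t (g' c)) ->
  is_derive (fun s => f (g s)) t
    (lsum (coords m N) (fun c => pd c f (g t) * g' c)).
Proof.
  intros Hdep Hf HO Hg.
  (* [mix l s] has moved the coordinates in l only; the induction on l adds one coordinate at each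
     step. *)
  set (mix := fun l s c => if in_dec coord_eq_dec c l then g s c else g t c).
  assert (Hm0 : forall l, mix l t = g t).
  { intros l; extensionality c; unfold mix; destruct in_dec; auto. }
  assert (Hg0 : Om (g t)) by (apply locally_singleton in HO; exact HO).
  assert (HOm : forall l s, Om (g s) -> Om (mix l s)).
  { intros l s Hs; unfold u_dom, mix; destruct in_dec; auto. }
  assert (Hloc : forall e, 0 < e -> locally t (fun s =>
             forall c, In c (coords m N) -> Rabs (g s c - g t c) < e)).
  { intros e He; apply locally_forall_in; intros c Hc.
    assert (Hcont : continuous (fun s => g s c) t)
      by (apply (@ex_derive_continuous R_AbsRing R_NormedModule); eexists; eauto).
    apply (proj1 (filterlim_locally _ _)) with (eps := mkposreal e He) in Hcont.
    exact Hcont. }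
  assert (Hmain : forall l, NoDup l -> incl l (coords m N) ->
    is_derive (fun s => f (mix l s)) t (lsum l (fun c => pd c f (g t) * g' c))).
  { induction l as [|c l IH]; intros Hn Hi; simpl.
    - apply (is_derive_ext (fun _ => f (g t))); [|apply @is_derive_const].
      intros s; reflexivity.
    - inversion Hn as [|? ? Hcl Hl]; subst.
      assert (Hic : In c (coords m N)) by (apply Hi; simpl; auto).
      apply (is_derive_ext
        (fun s => (f (mix (c :: l) s) - f (mix l s)) + f (mix l s)));
        [intros s; change (f (mix (c :: l) s) - f (mix l s) + f (mix l s)
                           = f (mix (c :: l) s)); ring|].
      apply @is_derive_plus;
        [|apply IH; auto; intros d Hd; apply Hi; simpl; auto].
      apply is_derive_mul_close with (h := fun s => g s c - g t c).
      + ring.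
      + generalize (is_derive_minus (fun s => g s c) (fun _ => g t c) t _ _
                     (Hg c Hic) (is_derive_const _ _)).
        unfold minus, plus, opp, zero; simpl; now rewrite Ropp_0, Rplus_0_r.
      + rewrite !Hm0; ring.
      + intros eps He.
        destruct (Hf [c] (g t) Hg0) as [_ Hcont].
        destruct (Hcont eps He) as [e [He' Hc]].
        generalize (filter_and _ _ HO (Hloc e He')); apply filter_imp.
        intros s [HOs Hs].
        assert (E1 : mix (c :: l) s = upd (mix l s) c (g s c)).
        { extensionality d; unfold upd, mix; simpl.
          destruct (coord_eq_dec c d) as [->|]; [reflexivity|].
          destruct (in_dec coord_eq_dec d l); reflexivity. }
        assert (E2 : mix l s = upd (mix l s) c (g t c)).
        { extensionality d; unfold upd; destruct (coord_eq_dec c d) as [->|]; auto.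
          unfold mix; destruct (in_dec coord_eq_dec d l); tauto. }
        destruct (MVT_gen (fun y => f (upd (mix l s) c y)) (g t c) (g s c)
                    (fun y => pd c f (upd (mix l s) c y))) as [y [Hy Ey]].
        * intros y Hy; eapply smooth_on_derive; eauto.
          apply (dom_conv_minmax c (g t c) (g s c)); auto using dom_at; lra.
        * intros y Hy; apply continuity_pt_filterlim.
          apply (@ex_derive_continuous R_AbsRing R_NormedModule).
          eexists; eapply smooth_on_derive; eauto.
          apply (dom_conv_minmax c (g t c) (g s c)); auto using dom_at.
        * exists (pd c f (upd (mix l s) c y)); split.
          -- apply Hc.
             ++ apply Om_upd; auto.
                apply (dom_conv_minmax c (g t c) (g s c)); auto using dom_at.
             ++ intros d Hd; apply relevant_coords in Hd.
                unfold upd; destruct (coord_eq_dec c d) as [->|].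
                ** apply Rle_lt_trans with (Rabs (g s d - g t d)); [|now apply Hs].
                   revert Hy; unfold Rmin, Rmax, Rabs.
                   destruct Rle_dec, Rcase_abs, Rcase_abs; lra.
                ** unfold mix; destruct in_dec; [now apply Hs|].
                   rewrite Rminus_diag, Rabs_R0; exact He'.
          -- rewrite E1, <- Ey; f_equal; now rewrite <- E2. }
  eapply is_derive_ext; [|apply Hmain; [apply NoDup_coords|apply incl_refl]].
  intros s; apply Hdep; intros c Hc; apply relevant_coords in Hc.
  unfold mix; destruct in_dec; tauto.
Qed.

(** Sums, products and substitutions are treated together because the derivative of a composite is a
    sum of products of composites: the joint class is stable under [pd], as the coinduction
    principle requires. [sc_zero] is the empty sum. *)
Inductive smooth_class (N : nat) : (jet -> R) -> Prop :=
| sc_base f : smooth_on m N Om f -> smooth_class N f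
| sc_zero : smooth_class N (fun _ => 0)
| sc_plus f g : smooth_class N f -> smooth_class N g ->
    smooth_class N (fun z => f z + g z)
| sc_mult f g : smooth_class N f -> smooth_class N g ->
    smooth_class N (fun z => f z * g z)
| sc_comp M f (s : jet -> jet) : depends_on m M f -> smooth_on m M Om f ->
    (forall z, Om z -> Om (s z)) ->
    (forall c, In c (coords m M) -> smooth_on m N Om (fun z => s z c)) ->
    smooth_class N (fun z => f (s z)).

Lemma smooth_class_lsum N (l : list coord) F :
  (forall c, In c l -> smooth_class N (F c)) ->
  smooth_class N (fun z => lsum l (fun c => F c z)).
Proof.
  induction l as [|c l IH]; intros H; simpl; [apply sc_zero|].
  apply sc_plus; [apply H; simpl; auto|apply IH; intros; apply H; simpl; auto].
Qed.

Lemma comp_is_derive N M f (s : jet -> jet) z c :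
  depends_on m M f -> smooth_on m M Om f ->
  (forall y, Om y -> Om (s y)) ->
  (forall d, In d (coords m M) -> smooth_on m N Om (fun y => s y d)) ->
  Om z ->
  is_derive (fun t => f (s (upd z c t))) (z c)
    (lsum (coords m M) (fun d => pd d f (s z) * pd c (fun y => s y d) z)).
Proof.
  intros H1 H2 H3 H4 Hz.
  replace (lsum (coords m M) (fun d => pd d f (s z) * pd c (fun y => s y d) z))
    with (lsum (coords m M) (fun d => pd d f (s (upd z c (z c))) *
            pd c (fun y => s y d) (upd z c (z c)))) by now rewrite upd_id.
  apply (chain_rule M f (fun t => s (upd z c t)) (z c)
           (fun d => pd c (fun y => s y d) (upd z c (z c)))); auto.
  - generalize (dom_locally c (z c) (dom_at z c Hz)); apply filter_imp.
    intros y Hy; apply H3, Om_upd; auto.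
  - intros d Hd; apply (smooth_on_derive N (fun y => s y d)); auto using dom_at.
Qed.

Lemma pd_comp N M f (s : jet -> jet) z c :
  depends_on m M f -> smooth_on m M Om f ->
  (forall y, Om y -> Om (s y)) ->
  (forall d, In d (coords m M) -> smooth_on m N Om (fun y => s y d)) ->
  Om z ->
  pd c (fun y => f (s y)) z =
    lsum (coords m M) (fun d => pd d f (s z) * pd c (fun y => s y d) z).
Proof. intros; apply is_derive_unique, (comp_is_derive N); auto. Qed.

Lemma smooth_class_regular N f : smooth_class N f ->
  forall z, Om z -> (forall c, ex_derive (fun s => f (upd z c s)) (z c)) /\
                    cont_at m N Om f z.
Proof.
  induction 1 as [f Hf| |f g _ IHf _ IHg|f g _ IHf _ IHg|M f s H1 H2 H3 H4];
    intros z Hz.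
  - apply (Hf [] z Hz).
  - split; [intros c; apply ex_derive_const|].
    intros eps He; exists 1; split; [lra|]; intros w _ _.
    now rewrite Rminus_diag, Rabs_R0.
  - destruct (IHf z Hz) as [Df Cf], (IHg z Hz) as [Dg Cg]; split.
    + intros c; apply @ex_derive_plus; auto.
    + intros eps He; destruct (Cf (eps / 2)) as [d [Hd Hf']]; [lra|].
      destruct (Cg (eps / 2)) as [e [He' Hg']]; [lra|].
      exists (Rmin d e); split; [now apply Rmin_glb_lt|]; intros w Hw Hc.
      assert (Rabs (f w - f z) < eps / 2).
      { apply Hf'; auto; intros c Hc'; eapply Rlt_le_trans; [now apply Hc|apply Rmin_l]. }
      assert (Rabs (g w - g z) < eps / 2).
      { apply Hg'; auto; intros c Hc'; eapply Rlt_le_trans; [now apply Hc|apply Rmin_r]. }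
      replace (f w + g w - (f z + g z)) with ((f w - f z) + (g w - g z)) by ring.
      eapply Rle_lt_trans; [apply Rabs_triang|lra].
  - destruct (IHf z Hz) as [Df Cf], (IHg z Hz) as [Dg Cg]; split.
    + intros c; apply ex_derive_mult; auto.
    + intros eps He; destruct (mul_close (f z) (g z) eps He) as [r [Hr Hm]].
      destruct (Cf r Hr) as [d [Hd Hf']], (Cg r Hr) as [e [He' Hg']].
      exists (Rmin d e); split; [now apply Rmin_glb_lt|]; intros w Hw Hc.
      apply Hm; [apply Hf'|apply Hg']; auto; intros c Hc';
        (eapply Rlt_le_trans; [now apply Hc|]); [apply Rmin_l|apply Rmin_r].
  - split.
    + intros c; eexists; apply (comp_is_derive N M f s z c); auto.
    + intros eps He.
      destruct (H2 [] (s z) (H3 z Hz)) as [_ Cf].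
      destruct (Cf eps He) as [r [Hr Hf']].
      destruct (min_delta (coords m M) (fun c d => forall w, Om w ->
        (forall c', relevant m N c' -> Rabs (w c' - z c') < d) ->
        Rabs (s w c - s z c) < r)) as [d [Hd Hs]].
      * intros c d d' Hd Hdd w Hw Hc; apply Hd; auto; intros c' Hc'.
        eapply Rlt_le_trans; [now apply Hc|auto].
      * intros c Hc; destruct (H4 c Hc [] z Hz) as [_ Cs].
        destruct (Cs r Hr) as [d Hd]; exists d; exact Hd.
      * exists d; split; auto; intros w Hw Hc.
        apply Hf'; auto; intros c Hc'; apply Hs; auto; now apply relevant_coords.
Qed.

Lemma pd_plus_class N f g c z : smooth_class N f -> smooth_class N g -> Om z ->
  pd c (fun y => f y + g y) z = pd c f z + pd c g z.
Proof.
  intros Hf Hg Hz; unfold pd; apply Derive_plus;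
    eapply smooth_class_regular; eauto.
Qed.

Lemma pd_mult_class N f g c z : smooth_class N f -> smooth_class N g -> Om z ->
  pd c (fun y => f y * g y) z = pd c f z * g z + f z * pd c g z.
Proof.
  intros Hf Hg Hz; unfold pd.
  rewrite Derive_mult by (eapply smooth_class_regular; eauto).
  now rewrite upd_id.
Qed.

Lemma smooth_class_smooth N f : smooth_class N f -> smooth_on m N Om f.
Proof.
  apply smooth_on_coind; clear f; intros f Hf.
  split; [now apply smooth_class_regular|]; intros c.
  induction Hf as [f Hf| |f g Hf [f' [Hf' Ef]] Hg [g' [Hg' Eg]]
    |f g Hf [f' [Hf' Ef]] Hg [g' [Hg' Eg]]|M f s H1 H2 H3 H4].
  - exists (pd c f); split; auto; now apply sc_base, smooth_on_pd.
  - exists (fun _ => 0); split; [apply sc_zero|]; intros z _; apply (Derive_const 0).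
  - exists (fun z => f' z + g' z); split; [now apply sc_plus|].
    intros z Hz; rewrite (pd_plus_class N), Ef, Eg; auto.
  - exists (fun z => f' z * g z + f z * g' z); split.
    { apply sc_plus; apply sc_mult; auto. }
    intros z Hz; rewrite (pd_mult_class N), Ef, Eg; auto.
  - exists (fun z => lsum (coords m M)
      (fun d => pd d f (s z) * pd c (fun y => s y d) z)); split.
    + apply (smooth_class_lsum N (coords m M)
        (fun d z => pd d f (s z) * pd c (fun y => s y d) z)).
      intros d Hd; apply sc_mult.
      * apply (sc_comp N M (pd d f)); auto using smooth_on_pd.
        now apply dep_pd.
      * apply sc_base, smooth_on_pd; auto.
    + intros z Hz; apply (pd_comp N); auto.
Qed.

End Calculus.

(** * Symmetry of second derivatives; primitives along a coordinate *)

Lemma RInt_bound (g : R -> R) a b K :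
  (forall s, Rmin a b <= s <= Rmax a b -> continuous g s) ->
  (forall s, Rmin a b <= s <= Rmax a b -> Rabs (g s) <= K) ->
  Rabs (RInt g a b) <= Rabs (b - a) * K.
Proof.
  unfold Rmin, Rmax; destruct (Rle_dec a b) as [H|H]; intros Hc HK.
  - rewrite (Rabs_pos_eq (b - a)) by lra.
    apply abs_RInt_le_const; auto.
    apply (@ex_RInt_continuous R_CompleteNormedModule).
    rewrite Rmin_left, Rmax_right by lra; auto.
  - rewrite <- (opp_RInt_swap g b a); unfold opp; simpl.
    + rewrite Rabs_Ropp, (Rabs_left1 (b - a)) by lra.
      replace (- (b - a)) with (a - b) by ring.
      apply abs_RInt_le_const; auto; [lra|].
      apply (@ex_RInt_continuous R_CompleteNormedModule).
      rewrite Rmin_left, Rmax_right by lra; auto.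
    + apply (@ex_RInt_continuous R_CompleteNormedModule).
      rewrite Rmin_left, Rmax_right by lra; auto.
Qed.

Definition prim (c : coord) (a : R) (f : jet -> R) : jet -> R :=
  fun z => RInt (fun s => f (upd z c s)) a (z c).

Section Primitives.

Variables (m : nat) (U : R -> Prop).
Hypothesis HU : is_open_interval U.

Notation Om := (u_dom U).
Notation dom := (dom U).

Lemma continuous_line N f z c y : smooth_on m N Om f -> Om z -> dom c y ->
  continuous (fun s => f (upd z c s)) y.
Proof.
  intros Hf Hz Hy; apply (@ex_derive_continuous R_AbsRing R_NormedModule).
  eexists; eapply smooth_on_derive; eauto.
Qed.

Lemma continuity_2d N f z c d x y : smooth_on m N Om f -> Om z -> c <> d ->
  dom d x -> dom c y ->
  continuity_2d_pt (fun u v => f (upd (upd z d u) c v)) x y.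
Proof.
  intros Hf Hz Hcd Hx Hy eps.
  assert (HOz : Om (upd (upd z d x) c y)) by auto using Om_upd.
  destruct (Hf [] _ HOz) as [_ Hc].
  destruct (Hc eps (cond_pos eps)) as [e [He Hw]].
  destruct (dom_open U HU d x Hx) as [r1 [Hr1 H1]].
  destruct (dom_open U HU c y Hy) as [r2 [Hr2 H2]].
  assert (Hp : 0 < Rmin e (Rmin r1 r2)) by (repeat apply Rmin_glb_lt; auto).
  exists (mkposreal _ Hp); simpl; intros u v Hu Hv.
  assert (G : forall q, q < Rmin e (Rmin r1 r2) -> q < e /\ q < r1 /\ q < r2).
  { intros q Hq; pose proof (Rmin_l e (Rmin r1 r2)); pose proof (Rmin_r e (Rmin r1 r2)).
    pose proof (Rmin_l r1 r2); pose proof (Rmin_r r1 r2); lra. }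
  apply G in Hu; apply G in Hv.
  apply Hw.
  - apply Om_upd; [apply Om_upd|]; auto; [apply H1|apply H2]; tauto.
  - intros c' _; unfold upd.
    destruct (coord_eq_dec c c'); [tauto|].
    destruct (coord_eq_dec d c'); [tauto|].
    now rewrite Rminus_diag, Rabs_R0.
Qed.

Lemma pd_upd2 f z c d u v : c <> d ->
  pd d f (upd (upd z d u) c v) = Derive (fun s => f (upd (upd z d s) c v)) u.
Proof.
  intros H; unfold pd; rewrite upd_other by auto; rewrite upd_same.
  apply Derive_ext; intros s.
  now rewrite (upd_comm (upd z d u)), upd_upd by auto.
Qed.

Lemma pd_upd2' f z c d u v : c <> d ->
  pd c f (upd (upd z d u) c v) = Derive (fun s => f (upd (upd z d u) c s)) v.
Proof.
  intros H; unfold pd; rewrite upd_same.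
  apply Derive_ext; intros s; now rewrite upd_upd.
Qed.

Lemma pd_comm N f c d z : smooth_on m N Om f -> Om z ->
  pd c (pd d f) z = pd d (pd c f) z.
Proof.
  intros Hf Hz; destruct (coord_eq_dec c d) as [->|E]; auto.
  assert (Ez : z = upd (upd z d (z d)) c (z c)).
  { rewrite upd_id; symmetry; apply upd_id. }
  assert (Hd : dom d (z d)) by now apply dom_at.
  assert (Hc : dom c (z c)) by now apply dom_at.
  set (F := fun u v => f (upd (upd z d u) c v)).
  assert (Edc : forall u v, pd d (pd c f) (upd (upd z d u) c v)
     = Derive (fun s => Derive (fun t => F s t) v) u).
  { intros u v; rewrite pd_upd2 by auto; apply Derive_ext; intros s.
    now rewrite pd_upd2'. }
  assert (Ecd : forall u v, pd c (pd d f) (upd (upd z d u) c v)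
     = Derive (fun s => Derive (fun t => F t s) u) v).
  { intros u v; rewrite pd_upd2' by auto; apply Derive_ext; intros s.
    now rewrite pd_upd2. }
  rewrite Ez at 1 2; rewrite Ecd, Edc; symmetry; apply Schwarz.
  - destruct (dom_open U HU d _ Hd) as [r1 [Hr1 H1]].
    destruct (dom_open U HU c _ Hc) as [r2 [Hr2 H2]].
    assert (Hp : 0 < Rmin r1 r2) by (now apply Rmin_glb_lt).
    exists (mkposreal _ Hp); simpl; intros u v Hu Hv.
    assert (Hu' : dom d u) by (apply H1; eapply Rlt_le_trans; [exact Hu|apply Rmin_l]).
    assert (Hv' : dom c v) by (apply H2; eapply Rlt_le_trans; [exact Hv|apply Rmin_r]).
    unfold F; repeat split.
    + eapply ex_derive_ext with (f := fun s => f (upd (upd z c v) d s)).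
      { intros t; now rewrite upd_comm. }
      eexists; eapply smooth_on_derive; eauto; now apply Om_upd.
    + eexists; eapply smooth_on_derive; eauto; now apply Om_upd.
    + eapply ex_derive_ext with (f := fun s => pd c f (upd (upd z c v) d s)).
      { intros t; rewrite upd_comm by auto; now apply pd_upd2'. }
      eexists; eapply smooth_on_derive; eauto using smooth_on_pd; now apply Om_upd.
    + eapply ex_derive_ext with (f := fun s => pd d f (upd (upd z d u) c s)).
      { intros t; now apply pd_upd2. }
      eexists; eapply smooth_on_derive; eauto using smooth_on_pd; now apply Om_upd.
  - eapply continuity_2d_pt_ext; [intros u v; apply Edc|].
    eapply continuity_2d; eauto using smooth_on_pd.
  - eapply continuity_2d_pt_ext; [intros u v; apply Ecd|].
    eapply continuity_2d; eauto using smooth_on_pd.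
Qed.

(** Continuity at each point of a segment is made uniform by compactness, so that two integrands
    along neighbouring lines are uniformly close. *)
Lemma tube N f z c p q eps : smooth_on m N Om f -> Om z ->
  p <= q -> dom c p -> dom c q -> 0 < eps ->
  exists d, 0 < d /\ forall w, Om w ->
    (forall c', relevant m N c' -> Rabs (w c' - z c') < d) ->
    forall s, p <= s <= q -> Rabs (f (upd w c s) - f (upd z c s)) < eps.
Proof.
  intros Hf Hz Hpq Hp Hq He.
  assert (Hd : forall s, exists d : posreal, p <= s <= q -> forall y, Om y ->
     (forall c', relevant m N c' -> Rabs (y c' - upd z c s c') < d) ->
     Rabs (f y - f (upd z c s)) < eps / 2).
  { intros s; destruct (classic (p <= s <= q)) as [Hs|Hs].
    - assert (HO : Om (upd z c s)).
      { apply Om_upd; auto; now apply (dom_conv U HU c p q). }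
      destruct (Hf [] _ HO) as [_ Hc].
      destruct (Hc (eps / 2)) as [d [Hd H]]; [lra|].
      exists (mkposreal d Hd); intros _; exact H.
    - exists (mkposreal 1 Rlt_0_1); tauto. }
  set (delta := fun s => proj1_sig (constructive_indefinite_description _ (Hd s))).
  assert (Hdelta : forall s, p <= s <= q -> forall y, Om y ->
     (forall c', relevant m N c' -> Rabs (y c' - upd z c s c') < delta s) ->
     Rabs (f y - f (upd z c s)) < eps / 2).
  { intros s; exact (proj2_sig (constructive_indefinite_description _ (Hd s))). }
  (* [d] is such that each s in [p, q] is [delta t]-close to some t in [p, q] with d <= [delta t].
     Both points to be compared are then [delta t]-close to the one over t. *)
  destruct (compactness_value_1d p q delta) as [d Hcomp].
  exists d; split; [apply cond_pos|]; intros w Hw Hwz s Hs.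
  destruct (NNPP _ (Hcomp s Hs)) as [t [Ht [Hst Hdt]]].
  assert (HO : forall y, Om y -> Om (upd y c s)).
  { intros y Hy; apply Om_upd; auto; now apply (dom_conv U HU c p q). }
  assert (H1 : Rabs (f (upd w c s) - f (upd z c t)) < eps / 2).
  { apply (Hdelta t Ht); auto; intros c' Hc'; unfold upd.
    destruct (coord_eq_dec c c'); auto.
    eapply Rlt_le_trans; [now apply Hwz|exact Hdt]. }
  assert (H2 : Rabs (f (upd z c s) - f (upd z c t)) < eps / 2).
  { apply (Hdelta t Ht); auto; intros c' Hc'; unfold upd.
    destruct (coord_eq_dec c c'); auto.
    rewrite Rminus_diag, Rabs_R0; apply cond_pos. }
  replace (f (upd w c s) - f (upd z c s)) with
    ((f (upd w c s) - f (upd z c t)) - (f (upd z c s) - f (upd z c t))) by ring.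
  eapply Rle_lt_trans; [apply Rabs_triang|]; rewrite Rabs_Ropp; lra.
Qed.

Section Integral.

Variables (N : nat) (c : coord) (a : R).
Hypotheses (Hrel : relevant m N c) (Ha : dom c a).

Lemma prim_dep S f : dep S f -> S c -> dep S (prim c a f).
Proof.
  intros Hf Hc z w E; unfold prim; rewrite (E c Hc).
  apply RInt_ext; intros s _; apply Hf; intros d Hd.
  unfold upd; destruct (coord_eq_dec c d); auto.
Qed.

Lemma prim_ex_RInt f z y : smooth_on m N Om f -> Om z -> dom c y ->
  ex_RInt (fun s => f (upd z c s)) a y.
Proof.
  intros Hf Hz Hy; apply (@ex_RInt_continuous R_CompleteNormedModule).
  intros s Hs; eapply continuous_line; eauto.
  now apply (dom_conv_minmax U HU c a y).
Qed.

Lemma prim_is_derive f z : smooth_on m N Om f -> Om z ->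
  is_derive (fun s => prim c a f (upd z c s)) (z c) (f z).
Proof.
  intros Hf Hz; assert (Hc : dom c (z c)) by now apply dom_at.
  apply (is_derive_ext (fun y => RInt (fun s => f (upd z c s)) a y)).
  { intros y; unfold prim; rewrite upd_same.
    apply RInt_ext; intros s _; now rewrite upd_upd. }
  replace (f z) with (f (upd z c (z c))) by now rewrite upd_id.
  apply (is_derive_RInt (fun s => f (upd z c s)) (fun y => RInt (fun s => f (upd z c s)) a y) a).
  - generalize (dom_locally U HU c _ Hc); apply filter_imp; intros y Hy.
    apply (@RInt_correct R_CompleteNormedModule), prim_ex_RInt; auto.
  - eapply continuous_line; eauto.
Qed.

Lemma prim_is_derive_other f z d : smooth_on m N Om f -> Om z -> d <> c ->
  is_derive (fun s => prim c a f (upd z d s)) (z d) (prim c a (pd d f) z).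
Proof.
  intros Hf Hz Hdc; assert (Hc : dom c (z c)) by now apply dom_at.
  assert (Hd : dom d (z d)) by now apply dom_at.
  apply (is_derive_ext (fun y => RInt (fun t => f (upd (upd z d y) c t)) a (z c))).
  { intros y; unfold prim; now rewrite upd_other by auto. }
  replace (prim c a (pd d f) z) with
    (RInt (fun t => Derive (fun y => f (upd (upd z d y) c t)) (z d)) a (z c)).
  2: { unfold prim; apply RInt_ext; intros t _; rewrite <- pd_upd2 by auto.
       now rewrite upd_id. }
  apply (is_derive_RInt_param (fun y t => f (upd (upd z d y) c t))).
  - generalize (dom_locally U HU d _ Hd); apply filter_imp; intros y Hy t Ht.
    assert (Hct : dom c t) by now apply (dom_conv_minmax U HU c a (z c)).
    eapply ex_derive_ext with (f := fun s => f (upd (upd z c t) d s)).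
    { intros s; now rewrite upd_comm. }
    eexists; eapply smooth_on_derive; eauto; now apply Om_upd.
  - intros t Ht.
    eapply continuity_2d_pt_ext; [intros u v; now apply pd_upd2|].
    eapply continuity_2d; eauto using smooth_on_pd.
    now apply (dom_conv_minmax U HU c a (z c)).
  - generalize (dom_locally U HU d _ Hd); apply filter_imp; intros y Hy.
    apply prim_ex_RInt; auto using Om_upd.
Qed.

Lemma pd_prim f z : smooth_on m N Om f -> Om z -> pd c (prim c a f) z = f z.
Proof. intros; now apply is_derive_unique, prim_is_derive. Qed.

Lemma pd_prim_other f z d : smooth_on m N Om f -> Om z -> d <> c ->
  pd d (prim c a f) z = prim c a (pd d f) z.
Proof. intros; now apply is_derive_unique, prim_is_derive_other. Qed.

Lemma prim_cont f z : smooth_on m N Om f -> Om z -> cont_at m N Om (prim c a f) z.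
Proof.
  intros Hf Hz eps He; assert (Hc : dom c (z c)) by now apply dom_at.
  destruct (dom_open U HU c _ Hc) as [r0 [Hr0 Hr]].
  (* Half the radius keeps the closed interval around [z c] in the domain, so one compact segment
     [p, q] contains the base point and all nearby upper limits. *)
  set (r := r0 / 2).
  assert (Hrp : 0 < r) by (unfold r; lra).
  set (p := Rmin a (z c - r)); set (q := Rmax a (z c + r)).
  assert (Hpa : p <= a) by apply Rmin_l.
  assert (Hpz : p <= z c - r) by apply Rmin_r.
  assert (Haq : a <= q) by apply Rmax_l.
  assert (Hzq : z c + r <= q) by apply Rmax_r.
  assert (Hdp : dom c p).
  { unfold p, Rmin; destruct Rle_dec; auto; apply Hr.
    replace (z c - r - z c) with (- r) by ring; rewrite Rabs_Ropp, Rabs_pos_eq; unfold r; lra. }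
  assert (Hdq : dom c q).
  { unfold q, Rmax; destruct Rle_dec; auto; apply Hr.
    replace (z c + r - z c) with r by ring; rewrite Rabs_pos_eq; unfold r; lra. }
  assert (Hpq : forall s, p <= s <= q -> dom c s)
    by (intros s Hs; now apply (dom_conv U HU c p q)).
  destruct (continuity_ab_maj (fun s => Rabs (f (upd z c s))) p q) as [s0 [HM _]].
  { lra. }
  { intros s Hs; apply continuity_pt_filterlim.
    apply (continuous_comp (fun s => f (upd z c s)) Rabs).
    - eapply continuous_line; eauto.
    - apply continuous_Rabs. }
  set (M := Rabs (f (upd z c s0))) in *.
  assert (HMp : 0 <= M) by apply Rabs_pos.
  (* The integral changes by at most |z c - a| [e1] on the old segment and |w c - z c| (M + [e1]) on
     the added piece. [e1] and [e2] allot half of eps to each, the + 1 keeping the denominators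
     positive. *)
  set (e1 := eps / 2 / (Rabs (z c - a) + 1)).
  assert (Hza := Rabs_pos (z c - a)).
  assert (He1 : 0 < e1) by (unfold e1; apply Rdiv_lt_0_compat; lra).
  destruct (tube N f z c p q e1) as [d [Hd Ht]]; auto; [lra|].
  set (e2 := eps / 2 / (M + e1 + 1)).
  assert (He2 : 0 < e2) by (unfold e2; apply Rdiv_lt_0_compat; lra).
  exists (Rmin d (Rmin r e2)); split; [repeat apply Rmin_glb_lt; auto|].
  intros w Hw Hwz.
  assert (G : forall c', relevant m N c' ->
            Rabs (w c' - z c') < d /\ Rabs (w c' - z c') < r /\ Rabs (w c' - z c') < e2).
  { intros c' Hc'; specialize (Hwz c' Hc').
    pose proof (Rmin_l d (Rmin r e2)); pose proof (Rmin_r d (Rmin r e2)).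
    pose proof (Rmin_l r e2); pose proof (Rmin_r r e2); lra. }
  assert (Hwc : z c - r <= w c <= z c + r).
  { destruct (G c Hrel) as [_ [Hg _]]; apply Rabs_def2 in Hg; lra. }
  assert (Hti : forall s, p <= s <= q -> Rabs (f (upd w c s) - f (upd z c s)) < e1).
  { apply Ht; auto; intros c' Hc'; now apply G. }
  assert (Hcw : forall s, p <= s <= q -> continuous (fun s => f (upd w c s)) s)
    by (intros; eapply continuous_line; eauto).
  assert (Hcz : forall s, p <= s <= q -> continuous (fun s => f (upd z c s)) s)
    by (intros; eapply continuous_line; eauto).
  assert (Haz : forall s, Rmin a (z c) <= s <= Rmax a (z c) -> p <= s <= q).
  { unfold Rmin, Rmax; intros s; destruct Rle_dec; lra. }
  assert (Hzw : forall s, Rmin (z c) (w c) <= s <= Rmax (z c) (w c) -> p <= s <= q).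
  { unfold Rmin, Rmax; intros s; destruct Rle_dec; lra. }
  assert (E : prim c a f w - prim c a f z =
     RInt (fun s => f (upd w c s) - f (upd z c s)) a (z c) +
     RInt (fun s => f (upd w c s)) (z c) (w c)).
  { unfold prim.
    rewrite <- (RInt_Chasles (fun s => f (upd w c s)) a (z c) (w c)).
    - rewrite (RInt_minus (fun s => f (upd w c s)) (fun s => f (upd z c s))).
      + unfold plus, minus, opp; simpl; unfold plus, opp; simpl; ring.
      + now apply prim_ex_RInt.
      + now apply prim_ex_RInt.
    - now apply prim_ex_RInt.
    - apply (@ex_RInt_continuous R_CompleteNormedModule); auto. }
  rewrite E; eapply Rle_lt_trans; [apply Rabs_triang|].
  assert (B1 : Rabs (RInt (fun s => f (upd w c s) - f (upd z c s)) a (z c))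
               <= Rabs (z c - a) * e1).
  { apply RInt_bound.
    - intros s Hs; apply (continuous_minus (fun s => f (upd w c s)) (fun s => f (upd z c s))); auto.
    - intros s Hs; left; auto. }
  assert (B2 : Rabs (RInt (fun s => f (upd w c s)) (z c) (w c))
               <= Rabs (w c - z c) * (M + e1)).
  { apply RInt_bound; auto.
    intros s Hs; specialize (Hti s (Hzw s Hs)); specialize (HM s (Hzw s Hs)).
    replace (f (upd w c s)) with
      ((f (upd w c s) - f (upd z c s)) + f (upd z c s)) by ring.
    eapply Rle_trans; [apply Rabs_triang|lra]. }
  destruct (G c Hrel) as [_ [_ Hg]].
  assert (K1 : e1 * (Rabs (z c - a) + 1) = eps / 2) by (unfold e1; field; lra).
  assert (K2 : e2 * (M + e1 + 1) = eps / 2) by (unfold e2; field; lra).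
  nra.
Qed.

(** Smooth functions together with their primitives form a class stable under [pd]: along c a
    primitive returns its integrand, along any other coordinate the derivative passes under the
    integral. *)
Lemma prim_smooth f : smooth_on m N Om f -> smooth_on m N Om (prim c a f).
Proof.
  intros Hf; apply (smooth_on_coind m U HU N (fun h =>
    smooth_on m N Om h \/ exists g, smooth_on m N Om g /\ h = prim c a g));
    [clear f Hf|eauto].
  intros h [Hh|[g [Hg ->]]].
  - split; [intros z Hz; apply (Hh [] z Hz)|].
    intros d; exists (pd d h); split; auto; left; now apply smooth_on_pd.
  - split.
    + intros z Hz; split; [|now apply prim_cont]; intros d.
      destruct (coord_eq_dec d c) as [->|E]; eexists.
      * now apply prim_is_derive.
      * now apply prim_is_derive_other.
    + intros d; destruct (coord_eq_dec d c) as [->|E].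
      * exists g; split; auto; intros z Hz; now apply pd_prim.
      * exists (prim c a (pd d g)); split; [right; eauto using smooth_on_pd|].
        intros z Hz; now apply pd_prim_other.
Qed.

End Integral.

(** The whole sequence of derivatives is supplied as [h], because it is the coinduction
    invariant. *)
Lemma smooth_on_coord N c (h : nat -> R -> R) : relevant m N c ->
  (forall n y, dom c y -> is_derive (h n) y (h (S n) y)) ->
  smooth_on m N Om (fun z => h 0%nat (z c)).
Proof.
  intros Hc Hh; apply (smooth_on_coind m U HU N (fun f =>
    f = (fun _ => 0) \/ exists n, f = fun z => h n (z c))); [|eauto].
  intros f [->|[n ->]].
  - split; [intros z Hz|].
    + apply (smooth_class_regular m U HU N (fun _ => 0)); auto; apply sc_zero.
    + intros d; exists (fun _ => 0); split; auto; intros z _; apply (Derive_const 0).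
  - split.
    + intros z Hz; split.
      * intros d; destruct (coord_eq_dec d c) as [->|E].
        -- exists (h (S n) (z c)).
           apply (is_derive_ext (h n)); [intros t; now rewrite upd_same|].
           apply Hh; now apply dom_at.
        -- apply (ex_derive_ext (fun _ => h n (z c)));
             [intros t; now rewrite upd_other by auto|apply ex_derive_const].
      * intros eps He.
        assert (Hcont : continuous (h n) (z c)).
        { apply (@ex_derive_continuous R_AbsRing R_NormedModule); eexists.
          apply Hh; now apply dom_at. }
        apply (proj1 (filterlim_locally _ _)) with (eps := mkposreal eps He) in Hcont.
        destruct Hcont as [d Hd]; exists d; split; [apply cond_pos|].
        intros w _ Hw; apply (Hd (w c)), Hw, Hc.
    + intros d; destruct (coord_eq_dec d c) as [->|E].
      * exists (fun z => h (S n) (z c)); split; eauto; intros z Hz.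
        apply is_derive_unique.
        apply (is_derive_ext (h n)); [intros t; now rewrite upd_same|].
        apply Hh; now apply dom_at.
      * exists (fun _ => 0); split; auto; intros z Hz.
        apply (dep_pd_zero (fun d => d = c)); auto.
        intros x y Exy; now rewrite Exy.
Qed.

End Primitives.

Section Fields.

Variables (m : nat) (U : R -> Prop).
Hypothesis HU : is_open_interval U.

Notation Om := (u_dom U).
Notation dom := (dom U).
Notation sm := (difffun m Om).

(** * Algebra of differential functions *)

Definition valid (c : coord) : Prop := exists N, relevant m N c.

Lemma dep_bound (F : coord -> jet -> R) l :
  (forall c, In c l -> sm (F c)) ->
  exists N, forall c, In c l -> depends_on m N (F c) /\ smooth_on m N Om (F c).
Proof.
  induction l as [|c l IH]; intros H; [exists 0%nat; simpl; tauto|].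
  destruct IH as [N HN]; [intros; apply H; simpl; auto|].
  destruct (H c (or_introl eq_refl)) as [M [H1 H2]].
  exists (max N M); intros d [<-|Hd].
  - split; [apply (depends_on_mono m M)|apply (smooth_on_mono m U M)]; auto; lia.
  - destruct (HN d Hd); split;
      [apply (depends_on_mono m N)|apply (smooth_on_mono m U N)]; auto; lia.
Qed.

Lemma sm_pd c f : sm f -> sm (pd c f).
Proof. intros [N [H1 H2]]; exists N; split; [now apply dep_pd|now apply smooth_on_pd]. Qed.

Lemma sm_common2 f g : sm f -> sm g -> exists N,
  (depends_on m N f /\ smooth_on m N Om f) /\ (depends_on m N g /\ smooth_on m N Om g).
Proof.
  intros [N [H1 H2]] [M [H3 H4]]; exists (max N M); split; split.
  - apply (depends_on_mono m N); auto; lia.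
  - apply (smooth_on_mono m U N); auto; lia.
  - apply (depends_on_mono m M); auto; lia.
  - apply (smooth_on_mono m U M); auto; lia.
Qed.

Lemma sm_plus f g : sm f -> sm g -> sm (fun z => f z + g z).
Proof.
  intros Hf Hg; destruct (sm_common2 f g Hf Hg) as [N [[H1 H2] [H3 H4]]].
  exists N; split.
  - intros z w E; now rewrite (H1 z w E), (H3 z w E).
  - apply (smooth_class_smooth m U HU), sc_plus; now apply sc_base.
Qed.

Lemma sm_mult f g : sm f -> sm g -> sm (fun z => f z * g z).
Proof.
  intros Hf Hg; destruct (sm_common2 f g Hf Hg) as [N [[H1 H2] [H3 H4]]].
  exists N; split.
  - intros z w E; now rewrite (H1 z w E), (H3 z w E).
  - apply (smooth_class_smooth m U HU), sc_mult; now apply sc_base.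
Qed.

Lemma sm_fun (h : nat -> R -> R) c : valid c ->
  (forall n y, dom c y -> is_derive (h n) y (h (S n) y)) ->
  sm (fun z => h 0%nat (z c)).
Proof.
  intros [N Hc] Hh; exists N; split; [|now apply smooth_on_coord].
  intros z w E; now rewrite (E c Hc).
Qed.

Lemma valid_x : valid Cx.
Proof. exists 0%nat; exact I. Qed.

Lemma valid_t : valid Ct.
Proof. exists 0%nat; exact I. Qed.

Lemma sm_const k : sm (fun _ => k).
Proof.
  apply (sm_fun (fun n _ => match n with O => k | _ => 0 end) Cx valid_x).
  intros [|n] y _; apply @is_derive_const.
Qed.

Lemma sm_coord c : valid c -> sm (fun z => z c).
Proof.
  intros Hc.
  apply (sm_fun (fun n y => match n with O => y | 1%nat => 1 | _ => 0 end) c Hc).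
  intros [|[|n]] y _; [apply @is_derive_id|apply @is_derive_const..].
Qed.

Lemma sm_scal k f : sm f -> sm (fun z => k * f z).
Proof. intros Hf; apply (sm_mult (fun _ => k)); auto using sm_const. Qed.

Lemma sm_opp f : sm f -> sm (fun z => - f z).
Proof.
  intros Hf; replace (fun z => - f z) with (fun z => -1 * f z)
    by (extensionality z; ring); now apply sm_scal.
Qed.

Lemma sm_minus f g : sm f -> sm g -> sm (fun z => f z - g z).
Proof. intros; apply sm_plus; auto using sm_opp. Qed.

Lemma sm_lsum (l : list coord) F : (forall c, In c l -> sm (F c)) ->
  sm (fun z => lsum l (fun c => F c z)).
Proof.
  induction l as [|c l IH]; intros H; simpl; [apply (sm_const 0)|].
  apply sm_plus; [apply H; simpl; auto|apply IH; intros; apply H; simpl; auto].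
Qed.

Lemma sm_comp f (s : jet -> jet) : sm f -> (forall z, Om z -> Om (s z)) ->
  (forall c, valid c -> sm (fun z => s z c)) -> sm (fun z => f (s z)).
Proof.
  intros [M [H1 H2]] Hs Hc.
  assert (Hl : forall c, In c (coords m M) -> valid c).
  { intros [| |k i j] Hi; [exact valid_t|exact valid_x|].
    apply In_coords in Hi; exists (i + j)%nat; simpl; lia. }
  destruct (dep_bound (fun c z => s z c) (coords m M)) as [N HN]; [auto|].
  exists N; split.
  - intros z w E; apply H1; intros c Hr; apply relevant_coords in Hr.
    now apply (HN c Hr).
  - apply (smooth_class_smooth m U HU), sc_comp with (M := M); auto.
    intros c Hi; now apply HN.
Qed.

Lemma sm_prim c a f : valid c -> dom c a -> sm f -> sm (prim c a f).
Proof.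
  intros [M Hc] Ha [N [H1 H2]].
  assert (Hc' : relevant m (max M N) c)
    by (destruct c; simpl in *; auto; lia).
  exists (max M N); split.
  - apply prim_dep; auto; eapply depends_on_mono; [|exact H1]; lia.
  - apply prim_smooth; auto; eapply smooth_on_mono; [| exact H2]; lia.
Qed.

Lemma sm_ex f c z : sm f -> Om z -> ex_derive (fun s => f (upd z c s)) (z c).
Proof. intros [N [_ H]] Hz; apply (H [] z Hz). Qed.

Lemma pd_plus f g c z : sm f -> sm g -> Om z ->
  pd c (fun y => f y + g y) z = pd c f z + pd c g z.
Proof. intros Hf Hg Hz; apply Derive_plus; now apply sm_ex. Qed.

Lemma pd_mult f g c z : sm f -> sm g -> Om z ->
  pd c (fun y => f y * g y) z = pd c f z * g z + f z * pd c g z.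
Proof.
  intros Hf Hg Hz; unfold pd; rewrite Derive_mult by now apply sm_ex.
  now rewrite upd_id.
Qed.

Lemma pd_const k c z : pd c (fun _ => k) z = 0.
Proof. apply (Derive_const k). Qed.

Lemma pd_scal k f c z : sm f -> Om z ->
  pd c (fun y => k * f y) z = k * pd c f z.
Proof.
  intros Hf Hz; rewrite (pd_mult (fun _ => k)) by auto using sm_const.
  rewrite pd_const; ring.
Qed.

Lemma pd_opp f c z : sm f -> Om z -> pd c (fun y => - f y) z = - pd c f z.
Proof.
  intros Hf Hz; unfold pd; now rewrite Derive_opp.
Qed.

Lemma pd_minus f g c z : sm f -> sm g -> Om z ->
  pd c (fun y => f y - g y) z = pd c f z - pd c g z.
Proof. intros Hf Hg Hz; apply Derive_minus; now apply sm_ex. Qed.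

Lemma pd_lsum (l : list coord) F c z : (forall d, In d l -> sm (F d)) -> Om z ->
  pd c (fun y => lsum l (fun d => F d y)) z = lsum l (fun d => pd c (F d) z).
Proof.
  induction l as [|d l IH]; intros H Hz; simpl; [apply (pd_const 0)|].
  rewrite pd_plus, IH; auto; intros; try apply H; simpl; auto.
  apply sm_lsum; intros; apply H; simpl; auto.
Qed.

Lemma pd_fun (h h' : R -> R) c z : dom c (z c) ->
  is_derive h (z c) (h' (z c)) -> pd c (fun y => h (y c)) z = h' (z c).
Proof.
  intros Hc Hh; apply is_derive_unique.
  apply (is_derive_ext h); [intros t; now rewrite upd_same|auto].
Qed.

Lemma pd_fun_other (h : R -> R) c d z : c <> d -> pd c (fun y => h (y d)) z = 0.
Proof.
  intros E; apply (dep_pd_zero (fun e => e = d)); auto.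
  intros x y Exy; now rewrite Exy.
Qed.

Lemma pd_coord c z : pd c (fun y => y c) z = 1.
Proof.
  apply is_derive_unique; apply (is_derive_ext (fun t => t)); [|apply @is_derive_id].
  intros t; now rewrite upd_same.
Qed.

Lemma sm_pd_comm f c d z : sm f -> Om z -> pd c (pd d f) z = pd d (pd c f) z.
Proof. intros [N [_ H]] Hz; now apply (pd_comm m U HU N). Qed.

(** * Functions depending, over the domain, on a set of coordinates *)

Definition depO (S : coord -> Prop) (f : jet -> R) : Prop :=
  forall z w, Om z -> Om w -> (forall c, S c -> z c = w c) -> f z = f w.

Lemma depO_mono (S S' : coord -> Prop) f :
  (forall c, S c -> S' c) -> depO S f -> depO S' f.
Proof. intros H Hf z w Hz Hw E; apply Hf; auto. Qed.

Lemma depO_pd S f c : depO S f -> depO S (pd c f).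
Proof.
  intros Hf z w Hz Hw E.
  destruct (classic (S c)) as [Hc|Hc].
  - unfold pd; rewrite (E c Hc); apply Derive_ext_loc.
    generalize (dom_locally U HU c (w c) (dom_at U w c Hw)); apply filter_imp.
    intros t Ht; apply Hf; auto using Om_upd.
    intros d Hd; unfold upd; destruct (coord_eq_dec c d); auto.
  - assert (G : forall y, Om y -> pd c f y = 0); [|now rewrite !G].
    intros y Hy; unfold pd.
    rewrite (Derive_ext_loc _ (fun _ => f y)); [apply Derive_const|].
    generalize (dom_locally U HU c (y c) (dom_at U y c Hy)); apply filter_imp.
    intros t Ht; apply Hf; auto using Om_upd.
    intros d Hd; apply upd_other; intros ->; tauto.
Qed.

Lemma depO_pd_zero S f c z : depO S f -> ~ S c -> Om z -> pd c f z = 0.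
Proof.
  intros Hf Hc Hz; unfold pd.
  rewrite (Derive_ext_loc _ (fun _ => f z)); [apply Derive_const|].
  generalize (dom_locally U HU c (z c) (dom_at U z c Hz)); apply filter_imp.
  intros t Ht; apply Hf; auto using Om_upd.
  intros d Hd; apply upd_other; intros ->; tauto.
Qed.

(** The lines of [Om] along c are intervals, so a vanishing partial derivative makes f constant on
    each of them. The hypothesis speaks of [Om] only, which is why dependence is measured by [depO]
    and not by [dep]. *)
Lemma depO_drop S f c : sm f -> depO S f ->
  (forall z, Om z -> pd c f z = 0) -> depO (fun d => S d /\ d <> c) f.
Proof.
  intros [N [_ Hf]] HS H0 z w Hz Hw E.
  assert (Hd : dom c (z c)) by now apply dom_at.
  assert (Hd' : dom c (w c)) by now apply dom_at.
  transitivity (f (upd w c (z c))).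
  - apply HS; auto using Om_upd; intros d HSd.
    unfold upd; destruct (coord_eq_dec c d) as [->|]; auto.
  - rewrite <- (upd_id w c) at 2.
    assert (Hder : forall y, Rmin (w c) (z c) <= y <= Rmax (w c) (z c) ->
              is_derive (fun s => f (upd w c s)) y 0).
    { intros y Hy.
      assert (Hy' : dom c y) by now apply (dom_conv_minmax U HU c (w c) (z c)).
      rewrite <- (H0 (upd w c y)) by now apply Om_upd.
      eapply smooth_on_derive; eauto. }
    destruct (MVT_gen (fun s => f (upd w c s)) (w c) (z c) (fun _ => 0))
      as [y [_ Ey]]; [| |lra].
    + intros y Hy; apply Hder; lra.
    + intros y Hy; apply continuity_pt_filterlim.
      apply (@ex_derive_continuous R_AbsRing R_NormedModule); eexists; now apply Hder.
Qed.

Lemma depO_prim S c a f : dom c a -> depO S f -> S c -> depO S (prim c a f).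
Proof.
  intros Ha Hf Hc z w Hz Hw E; unfold prim; rewrite (E c Hc).
  apply RInt_ext; intros s Hs.
  assert (Hs' : dom c s).
  { apply (dom_conv_minmax U HU c a (w c)); auto using dom_at; lra. }
  apply Hf; auto using Om_upd; intros d Hd.
  unfold upd; destruct (coord_eq_dec c d); auto.
Qed.

(** * First-order differential operators *)

(* Some order of [f], so that [op] need not carry a bound; by [op_coords] the
   choice is immaterial. *)
Definition ord (f : jet -> R) : nat :=
  epsilon (inhabits 0%nat) (fun N => depends_on m N f).

Definition op (V : coord -> jet -> R) (f : jet -> R) : jet -> R :=
  fun z => lsum (coords m (ord f)) (fun c => V c z * pd c f z).

Lemma ord_spec f : sm f -> depends_on m (ord f) f.
Proof.
  intros [N [H _]]; unfold ord; apply epsilon_spec; eauto.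
Qed.

Lemma pd_out f N c z : depends_on m N f -> ~ In c (coords m N) -> pd c f z = 0.
Proof.
  intros Hf Hc; apply (dep_pd_zero (relevant m N)); auto.
  intros Hr; now apply Hc, relevant_coords.
Qed.

Lemma op_list V f l z : sm f -> NoDup l ->
  (forall c, ~ In c l -> V c z * pd c f z = 0) ->
  op V f z = lsum l (fun c => V c z * pd c f z).
Proof.
  intros Hf Hl H; apply lsum_support; auto using NoDup_coords.
  intros c _ Hc; rewrite (pd_out f _ c z (ord_spec f Hf) Hc); ring.
Qed.

Lemma op_coords V f N z : sm f -> depends_on m N f ->
  op V f z = lsum (coords m N) (fun c => V c z * pd c f z).
Proof.
  intros Hf HN; apply op_list; auto using NoDup_coords.
  intros c Hc; rewrite (pd_out f _ c z HN Hc); ring.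
Qed.

Section Op.

Variable V : coord -> jet -> R.
Hypothesis HV : forall c, sm (V c).

Lemma sm_op f : sm f -> sm (op V f).
Proof.
  intros Hf; apply sm_lsum; intros c _; apply sm_mult; auto using sm_pd.
Qed.

Lemma op_ext f g z : sm f -> sm g -> (forall y, Om y -> f y = g y) -> Om z ->
  op V f z = op V g z.
Proof.
  intros Hf Hg E Hz; destruct (sm_common2 f g Hf Hg) as [N [[H1 _] [H2 _]]].
  rewrite (op_coords V f N), (op_coords V g N) by auto.
  apply lsum_ext; intros c _; now rewrite (pd_ext_on U HU c f g).
Qed.

Lemma op_plus f g z : sm f -> sm g -> Om z ->
  op V (fun y => f y + g y) z = op V f z + op V g z.
Proof.
  intros Hf Hg Hz; destruct (sm_common2 f g Hf Hg) as [N [[H1 _] [H2 _]]].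
  rewrite (op_coords V f N), (op_coords V g N), (op_coords V _ N), <- lsum_plus;
    auto using sm_plus.
  - apply lsum_ext; intros c _; rewrite pd_plus by auto; ring.
  - intros y w E; now rewrite (H1 y w E), (H2 y w E).
Qed.

Lemma op_mult f g z : sm f -> sm g -> Om z ->
  op V (fun y => f y * g y) z = op V f z * g z + f z * op V g z.
Proof.
  intros Hf Hg Hz; destruct (sm_common2 f g Hf Hg) as [N [[H1 _] [H2 _]]].
  rewrite (op_coords V f N), (op_coords V g N), (op_coords V _ N), Rmult_comm,
    <- !lsum_scal, <- lsum_plus; auto using sm_mult.
  - apply lsum_ext; intros c _; rewrite pd_mult by auto; ring.
  - intros y w E; now rewrite (H1 y w E), (H2 y w E).
Qed.

Lemma op_const k z : op V (fun _ => k) z = 0.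
Proof. apply lsum_zero; intros c _; rewrite pd_const; ring. Qed.

Lemma op_scal k f z : sm f -> Om z -> op V (fun y => k * f y) z = k * op V f z.
Proof.
  intros Hf Hz; rewrite (op_mult (fun _ => k)), op_const by auto using sm_const; ring.
Qed.

Lemma op_opp f z : sm f -> Om z -> op V (fun y => - f y) z = - op V f z.
Proof.
  intros Hf Hz; rewrite (op_ext _ (fun y => -1 * f y)); auto using sm_opp, sm_scal.
  - rewrite op_scal by auto; ring.
  - intros; ring.
Qed.

Lemma op_minus f g z : sm f -> sm g -> Om z ->
  op V (fun y => f y - g y) z = op V f z - op V g z.
Proof.
  intros; unfold Rminus; rewrite (op_plus f (fun y => - g y)), op_opp; auto using sm_opp.
Qed.

Lemma op_fun (h : nat -> R -> R) c z : valid c ->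
  (forall n y, dom c y -> is_derive (h n) y (h (S n) y)) -> Om z ->
  op V (fun y => h 0%nat (y c)) z = V c z * h 1%nat (z c).
Proof.
  intros Hc Hh Hz; rewrite (op_list V _ [c]).
  - simpl; rewrite (pd_fun (h 0%nat) (h 1%nat)); auto using dom_at; ring.
  - now apply sm_fun.
  - repeat constructor; simpl; tauto.
  - intros d Hd; rewrite pd_fun_other; [ring|intros ->; apply Hd; simpl; auto].
Qed.

Lemma op_coord c z : valid c -> Om z -> op V (fun y => y c) z = V c z.
Proof.
  intros Hc Hz; rewrite (op_list V _ [c]).
  - simpl; rewrite pd_coord; ring.
  - now apply sm_coord.
  - repeat constructor; simpl; tauto.
  - intros d Hd; rewrite (pd_fun_other (fun y => y)); [ring|].
    intros ->; apply Hd; simpl; auto.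
Qed.

(** The last sum is the commutator of the coordinate field and V. All extractions of leading
    coefficients below rest on this formula. *)
Lemma pd_op f N c z : sm f -> depends_on m N f -> Om z ->
  pd c (op V f) z = op V (pd c f) z +
    lsum (coords m N) (fun d => pd c (V d) z * pd d f z).
Proof.
  intros Hf HN Hz.
  rewrite (op_coords V (pd c f) N) by (auto using sm_pd; now apply dep_pd).
  rewrite (pd_ext_on U HU c _ (fun y => lsum (coords m N)
    (fun d => (fun d y => V d y * pd d f y) d y)));
    [|intros; now apply op_coords|auto].
  rewrite (pd_lsum (coords m N) (fun d y => V d y * pd d f y)); auto.
  - rewrite <- lsum_plus; apply lsum_ext; intros d _.
    rewrite pd_mult, (sm_pd_comm f c d) by auto using sm_pd; ring.
  - intros d _; auto using sm_mult, sm_pd.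
Qed.

Lemma op_comp f N (s : jet -> jet) z : sm f -> depends_on m N f ->
  (forall y, Om y -> Om (s y)) -> (forall c, valid c -> sm (fun y => s y c)) -> Om z ->
  op V (fun y => f (s y)) z =
    lsum (coords m N) (fun c => pd c f (s z) * op V (fun y => s y c) z).
Proof.
  intros Hf HN Hs Hc Hz.
  assert (Hsm : sm (fun y => f (s y))) by now apply sm_comp.
  assert (Hl : forall c, In c (coords m N) -> valid c).
  { intros [| |k i j] Hi; [exact valid_t|exact valid_x|].
    apply In_coords in Hi; exists (i + j)%nat; simpl; lia. }
  destruct (dep_bound (fun c y => s y c) (coords m N)) as [M HM]; [auto|].
  destruct Hf as [N1 [HN1 Hf1]].
  (* The given bound N and the order N1 witnessing smoothness may differ; the chain rule is applied
     at their maximum, where the additional coordinates contribute zero. *)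
  assert (Hf : smooth_on m (max N N1) Om f) by (eapply smooth_on_mono; [|exact Hf1]; lia).
  rewrite (op_coords V _ M); auto.
  2: { intros y w E; apply HN; intros c Hr; apply relevant_coords in Hr.
       now apply (HM c Hr). }
  rewrite (lsum_ext _ _ (fun d => lsum (coords m N) (fun c =>
    V d z * (pd c f (s z) * pd d (fun y => s y c) z)))).
  2: { intros d _; rewrite lsum_scal; f_equal.
       assert (HfN : forall y, Om y -> is_derive (fun t => f (s (upd y d t))) (y d)
          (lsum (coords m N) (fun c => pd c f (s y) * pd d (fun y => s y c) y))).
       { intros y Hy.
         replace (lsum (coords m N) (fun c => pd c f (s y) * pd d (fun y => s y c) y))
           with (lsum (coords m (max N N1)) (fun c => pd c f (s y) * pd d (fun y => s y c) y)).
         - destruct (dep_bound (fun c y => s y c) (coords m (max N N1))) as [M' HM'].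
           { intros c Hi; apply Hc; destruct c as [| |k i j];
               [exact valid_t|exact valid_x|].
             apply In_coords in Hi; exists (i + j)%nat; simpl; lia. }
           apply (comp_is_derive m U HU M'); auto.
           + eapply depends_on_mono; [|exact HN]; lia.
           + intros c Hi; now apply HM'.
         - apply lsum_support; auto using NoDup_coords.
           + intros c _ Hi; rewrite (pd_out f N) by auto; ring.
           + intros [| |k i j] Hi Hn; [simpl in Hn; tauto..|].
             exfalso; apply Hn, In_coords; apply In_coords in Hi; lia. }
       now apply is_derive_unique, HfN. }
  rewrite lsum_swap; apply lsum_ext; intros c Hi.
  rewrite (op_coords V (fun y => s y c) M) by (try apply HM; auto).
  rewrite <- lsum_scal; apply lsum_ext; intros d _; ring.
Qed.

Lemma depO_op (S S' : coord -> Prop) f : sm f -> (forall c, S c -> S' c) ->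
  (forall c, S c -> depO S' (V c)) -> depO S f -> depO S' (op V f).
Proof.
  intros Hf HS HV' HfS z w Hz Hw E; unfold op.
  apply lsum_ext; intros c _.
  destruct (classic (S c)) as [Hc|Hc].
  - rewrite (HV' c Hc z w) by auto; f_equal.
    apply (depO_pd S f c HfS); auto.
  - rewrite !(depO_pd_zero S f c) by auto; ring.
Qed.

End Op.

(** The second-order parts of both compositions agree by symmetry of second derivatives, so the
    commutator of two fields is again a field. Commutation can thus be tested on coordinates. *)
Lemma op_comm V W f N z : (forall c, sm (V c)) -> (forall c, sm (W c)) ->
  sm f -> depends_on m N f -> Om z ->
  op V (op W f) z = op W (op V f) z +
    lsum (coords m N) (fun c => (op V (W c) z - op W (V c) z) * pd c f z).
Proof.
  intros HV HW Hf HN Hz.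
  assert (G : forall V W, (forall c, sm (V c)) -> (forall c, sm (W c)) ->
    op V (op W f) z =
    lsum (coords m N) (fun d => lsum (coords m N) (fun c =>
      V d z * W c z * pd d (pd c f) z)) +
    lsum (coords m N) (fun c => op V (W c) z * pd c f z)).
  { clear V W HV HW; intros V W HV HW.
    destruct (dep_bound W (coords m N)) as [M1 HM1]; [auto|].
    destruct (sm_op W HW f Hf) as [M2 [HM2 _]].
    set (M := max N (max M1 M2)).
    rewrite (op_coords V (op W f) M) by
      (auto using sm_op; apply (depends_on_mono m M2); auto; lia).
    rewrite (lsum_ext _ _ (fun d =>
      V d z * op W (pd d f) z + lsum (coords m N) (fun c =>
        V d z * (pd d (W c) z * pd c f z)))).
    2: { intros d _; rewrite lsum_scal, (pd_op W HW f N) by auto; ring. }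
    rewrite lsum_plus; f_equal.
    - rewrite (lsum_support (coords m M) (coords m N)); auto using NoDup_coords.
      + apply lsum_ext; intros d _.
        rewrite (op_coords W (pd d f) N) by (auto using sm_pd; now apply dep_pd).
        rewrite <- lsum_scal; apply lsum_ext; intros c _.
        rewrite (sm_pd_comm f d c) by auto; ring.
      + intros d _ Hd.
        rewrite (op_ext W (pd d f) (fun _ => 0)), op_const; auto using sm_pd, sm_const;
          [ring|intros y _; now apply (pd_out f N)].
      + intros [| |k i j] Hi Hn; [simpl in Hn; tauto..|].
        exfalso; apply Hn, In_coords; apply In_coords in Hi; lia.
    - rewrite lsum_swap; apply lsum_ext; intros c Hc.
      rewrite (op_coords V (W c) M).
      + rewrite Rmult_comm, <- lsum_scal; apply lsum_ext; intros d _; ring.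
      + auto.
      + eapply depends_on_mono; [|apply HM1; auto]; lia. }
  rewrite (G V W), (G W V) by auto.
  rewrite (lsum_swap (coords m N) (coords m N) (fun d c => V d z * W c z * pd d (pd c f) z)).
  rewrite (lsum_ext _ (fun d => lsum _ (fun c => V c z * W d z * pd c (pd d f) z))
    (fun d => lsum (coords m N) (fun c => W d z * V c z * pd d (pd c f) z))).
  2: { intros d _; apply lsum_ext; intros c _; rewrite (sm_pd_comm f c d) by auto; ring. }
  rewrite Rplus_assoc; f_equal; rewrite <- lsum_plus; apply lsum_ext; intros; ring.
Qed.

(** * Total derivatives as vector fields, and their iterates *)

Definition field_x (c : coord) (z : jet) : R :=
  match c with Ct => 0 | Cx => 1 | Cu k i j => z (Cu k i (S j)) end.

Definition field_t (c : coord) (z : jet) : R :=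
  match c with Ct => 1 | Cx => 0 | Cu k i j => z (Cu k (S i) j) end.

Lemma lsum_coords N f : lsum (coords m N) f =
  f Ct + f Cx + sumR m (fun k => sumR (S N) (fun i => sumR (S N) (fun j => f (Cu k i j)))).
Proof.
  unfold coords; cbn [lsum fold_right].
  change (fold_right (fun c a => f c + a) 0) with (fun l => lsum l f); cbv beta.
  rewrite lsum_map, lsum_prod, lsum_seq; cbn [fst snd].
  rewrite Rplus_assoc; do 2 f_equal.
  f_equal; extensionality k; rewrite lsum_prod, lsum_seq.
  f_equal; extensionality i; now rewrite lsum_seq.
Qed.

Lemma Dx_lsum N f z :
  Dx m N f z = lsum (coords m N) (fun c => field_x c z * pd c f z).
Proof. rewrite lsum_coords; unfold Dx, field_x; cbn [field_x]; ring. Qed.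

Lemma Dt_lsum N f z :
  Dt m N f z = lsum (coords m N) (fun c => field_t c z * pd c f z).
Proof. rewrite lsum_coords; unfold Dt, field_t; cbn [field_t]; ring. Qed.

Lemma coords_valid N c : In c (coords m N) -> valid c.
Proof.
  destruct c as [| |k i j]; intros H; [exact valid_t|exact valid_x|].
  apply In_coords in H; exists (i + j)%nat; simpl; lia.
Qed.

Lemma sm_field_x c : valid c -> sm (field_x c).
Proof.
  destruct c as [| |k i j]; intros Hc; [apply (sm_const 0)|apply (sm_const 1)|].
  apply (sm_coord (Cu k i (S j))); destruct Hc as [N [H1 H2]].
  exists (S N); simpl; lia.
Qed.

Lemma sm_field_t c : valid c -> sm (field_t c).
Proof.
  destruct c as [| |k i j]; intros Hc; [apply (sm_const 1)|apply (sm_const 0)|].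
  apply (sm_coord (Cu k (S i) j)); destruct Hc as [N [H1 H2]].
  exists (S N); simpl; lia.
Qed.

Lemma sm_Dx N f : sm f -> sm (Dx m N f).
Proof.
  intros Hf.
  replace (Dx m N f) with (fun z => lsum (coords m N) (fun c => field_x c z * pd c f z))
    by (extensionality z; now rewrite Dx_lsum).
  apply (sm_lsum _ (fun c z => field_x c z * pd c f z)); intros c Hc.
  apply sm_mult; auto using sm_pd; eauto using sm_field_x, coords_valid.
Qed.

Lemma sm_Dt N f : sm f -> sm (Dt m N f).
Proof.
  intros Hf.
  replace (Dt m N f) with (fun z => lsum (coords m N) (fun c => field_t c z * pd c f z))
    by (extensionality z; now rewrite Dt_lsum).
  apply (sm_lsum _ (fun c z => field_t c z * pd c f z)); intros c Hc.
  apply sm_mult; auto using sm_pd; eauto using sm_field_t, coords_valid.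
Qed.

Lemma dep_Dx (S S' : coord -> Prop) N f : (forall c, S c -> S' c) ->
  (forall c, S c -> dep S' (field_x c)) -> dep S f -> dep S' (Dx m N f).
Proof.
  intros HS HV Hf z w E; rewrite !Dx_lsum; apply lsum_ext; intros c _.
  destruct (classic (S c)) as [Hc|Hc].
  - rewrite (HV c Hc z w), (dep_pd S f c Hf z w); auto.
  - rewrite !(dep_pd_zero S f c) by auto; ring.
Qed.

Lemma dep_Dt (S S' : coord -> Prop) N f : (forall c, S c -> S' c) ->
  (forall c, S c -> dep S' (field_t c)) -> dep S f -> dep S' (Dt m N f).
Proof.
  intros HS HV Hf z w E; rewrite !Dt_lsum; apply lsum_ext; intros c _.
  destruct (classic (S c)) as [Hc|Hc].
  - rewrite (HV c Hc z w), (dep_pd S f c Hf z w); auto.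
  - rewrite !(dep_pd_zero S f c) by auto; ring.
Qed.

Lemma depends_on_Dx N f : depends_on m N f -> depends_on m (S N) (Dx m N f).
Proof.
  apply dep_Dx; intros [| |k i j]; simpl; auto; try lia; intros Hc z w E; auto.
  apply (E (Cu k i (S j))); simpl; lia.
Qed.

Lemma depends_on_Dt N f : depends_on m N f -> depends_on m (S N) (Dt m N f).
Proof.
  apply dep_Dt; intros [| |k i j]; simpl; auto; try lia; intros Hc z w E; auto.
  apply (E (Cu k (S i) j)); simpl; lia.
Qed.

Lemma Dxs_regular N q f : depends_on m N f -> sm f ->
  depends_on m (N + q) (Dxs m q N f) /\ sm (Dxs m q N f).
Proof.
  intros Hd Hf; induction q as [|q [IH1 IH2]]; simpl.
  - now rewrite Nat.add_0_r.
  - rewrite Nat.add_succ_r; split; [now apply depends_on_Dx|now apply sm_Dx].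
Qed.

Lemma Dts_regular N p f : depends_on m N f -> sm f ->
  depends_on m (N + p) (Dts m p N f) /\ sm (Dts m p N f).
Proof.
  intros Hd Hf; induction p as [|p [IH1 IH2]]; simpl.
  - now rewrite Nat.add_0_r.
  - rewrite Nat.add_succ_r; split; [now apply depends_on_Dt|now apply sm_Dt].
Qed.

Lemma Dx_ext N f g z : (forall y, Om y -> f y = g y) -> Om z ->
  Dx m N f z = Dx m N g z.
Proof.
  intros E Hz; rewrite !Dx_lsum; apply lsum_ext; intros c _.
  now rewrite (pd_ext_on U HU c f g).
Qed.

Lemma Dt_ext N f g z : (forall y, Om y -> f y = g y) -> Om z ->
  Dt m N f z = Dt m N g z.
Proof.
  intros E Hz; rewrite !Dt_lsum; apply lsum_ext; intros c _.
  now rewrite (pd_ext_on U HU c f g).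
Qed.

Lemma Dx_minus N f g z : sm f -> sm g -> Om z ->
  Dx m N (fun y => f y - g y) z = Dx m N f z - Dx m N g z.
Proof.
  intros Hf Hg Hz; rewrite !Dx_lsum.
  replace (lsum (coords m N) (fun c => field_x c z * pd c f z) -
    lsum (coords m N) (fun c => field_x c z * pd c g z)) with
    (lsum (coords m N) (fun c => field_x c z * pd c f z) +
    (-1) * lsum (coords m N) (fun c => field_x c z * pd c g z)) by ring.
  rewrite <- lsum_scal, <- lsum_plus; apply lsum_ext; intros c _.
  rewrite pd_minus by auto; ring.
Qed.

Lemma Dt_minus N f g z : sm f -> sm g -> Om z ->
  Dt m N (fun y => f y - g y) z = Dt m N f z - Dt m N g z.
Proof.
  intros Hf Hg Hz; rewrite !Dt_lsum.
  replace (lsum (coords m N) (fun c => field_t c z * pd c f z) -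
    lsum (coords m N) (fun c => field_t c z * pd c g z)) with
    (lsum (coords m N) (fun c => field_t c z * pd c f z) +
    (-1) * lsum (coords m N) (fun c => field_t c z * pd c g z)) by ring.
  rewrite <- lsum_scal, <- lsum_plus; apply lsum_ext; intros c _.
  rewrite pd_minus by auto; ring.
Qed.

Lemma coord_lsum V N c z : relevant m N c ->
  lsum (coords m N) (fun d => V d z * pd d (fun y => y c) z) = V c z.
Proof.
  intros Hc; rewrite (lsum_single _ c); auto using NoDup_coords, relevant_coords.
  - rewrite pd_coord; ring.
  - intros d Hd; rewrite (pd_fun_other (fun y => y)) by auto; ring.
Qed.

Lemma Dxs_coord q N k i j z : relevant m N (Cu k i j) ->
  Dxs m q N (fun y => y (Cu k i j)) z = z (Cu k i (j + q)%nat).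
Proof.
  intros Hc; revert z; induction q as [|q IH]; intros z; simpl.
  - now rewrite Nat.add_0_r.
  - replace (Dxs m q N (fun y : jet => y (Cu k i j)))
      with (fun y : jet => y (Cu k i (j + q)%nat)) by (extensionality y; now rewrite IH).
    rewrite Dx_lsum, (coord_lsum field_x) by (simpl in *; lia).
    simpl; now rewrite Nat.add_succ_r.
Qed.

Lemma Dts_coord p N k i j z : relevant m N (Cu k i j) ->
  Dts m p N (fun y => y (Cu k i j)) z = z (Cu k (i + p)%nat j).
Proof.
  intros Hc; revert z; induction p as [|p IH]; intros z; simpl.
  - now rewrite Nat.add_0_r.
  - replace (Dts m p N (fun y : jet => y (Cu k i j)))
      with (fun y : jet => y (Cu k (i + p)%nat j)) by (extensionality y; now rewrite IH).
    rewrite Dt_lsum, (coord_lsum field_t) by (simpl in *; lia).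
    simpl; now rewrite Nat.add_succ_r.
Qed.

Lemma Dxs_minus q N f g z : depends_on m N f -> sm f -> depends_on m N g -> sm g ->
  Om z -> Dxs m q N (fun y => f y - g y) z = Dxs m q N f z - Dxs m q N g z.
Proof.
  intros Df Hf Dg Hg; revert z; induction q as [|q IH]; intros z Hz; simpl; auto.
  rewrite (Dx_ext _ _ _ z IH Hz); apply Dx_minus; auto; now apply Dxs_regular.
Qed.

Lemma Dts_minus p N f g z : depends_on m N f -> sm f -> depends_on m N g -> sm g ->
  Om z -> Dts m p N (fun y => f y - g y) z = Dts m p N f z - Dts m p N g z.
Proof.
  intros Df Hf Dg Hg; revert z; induction p as [|p IH]; intros z Hz; simpl; auto.
  rewrite (Dt_ext _ _ _ z IH Hz); apply Dt_minus; auto; now apply Dts_regular.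
Qed.

Lemma Dts_ext p N f g z : (forall y, Om y -> f y = g y) -> Om z ->
  Dts m p N f z = Dts m p N g z.
Proof.
  intros E; revert z; induction p as [|p IH]; intros z Hz; simpl; auto.
  now apply Dt_ext.
Qed.

(** An equation solved for a derivative stays solved under differentiation, which is how solution
    jets are determined by few coordinates. *)
Lemma Dts_Dxs_solved p q N k i j g z : relevant m N (Cu k i j) ->
  depends_on m N g -> sm g -> Om z ->
  Dts m p (N + q) (Dxs m q N (fun y => y (Cu k i j) - g y)) z =
    z (Cu k (i + p)%nat (j + q)%nat) - Dts m p (N + q) (Dxs m q N g) z.
Proof.
  intros Hc Dg Hg Hz.
  assert (Hv : valid (Cu k i j)) by (exists N; exact Hc).
  assert (Dc : depends_on m N (fun y => y (Cu k i j))) by (intros y w E; now apply E).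
  rewrite (Dts_ext _ _ _ (fun y => y (Cu k i (j + q)%nat) - Dxs m q N g y)); auto.
  - destruct (Dxs_regular N q g Dg Hg) as [D1 S1].
    assert (Hr : relevant m (N + q) (Cu k i (j + q))) by (simpl in *; lia).
    rewrite (Dts_minus p (N + q) (fun y => y (Cu k i (j + q)%nat))); auto.
    + now rewrite Dts_coord.
    + intros y w E; now apply E.
    + apply sm_coord; eexists; eauto.
  - intros y Hy; rewrite (Dxs_minus q N (fun y => y (Cu k i j))); auto using sm_coord.
    now rewrite Dxs_coord.
Qed.

End Fields.

(** * Conservation laws in the coordinates of the solution set *)

Fixpoint iter_op (k : nat) (Dred : (jet -> R) -> jet -> R) (f : jet -> R) : jet -> R :=
  match k with O => f | S k => Dred (iter_op k Dred f) end.

(* The jet coordinates of the restricted problem: s_0 = v^2 - phi v^1 is stored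
   in the slot of v^2, s_1 = v^1, and s_{k+2} is the k-th x-derivative of u. *)
Definition jc (k : nat) : coord :=
  match k with O => Cu 2 0 0 | 1%nat => Cu 1 0 0 | S (S k) => Cu 0 0 k end.

Lemma s_inj j k : jc j = jc k -> j = k.
Proof. destruct j as [|[|j]], k as [|[|k]]; simpl; congruence. Qed.

Lemma s_not_t k : jc k <> Ct.
Proof. destruct k as [|[|k]]; discriminate. Qed.

Lemma s_not_x k : jc k <> Cx.
Proof. destruct k as [|[|k]]; discriminate. Qed.

Lemma valid_s k : valid 3 (jc k).
Proof. exists k; destruct k as [|[|k]]; simpl; lia. Qed.

Lemma lsum_single' (l : list coord) c f : NoDup l ->
  (forall d, d <> c -> f d = 0) -> (~ In c l -> f c = 0) -> lsum l f = f c.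
Proof.
  intros Hl Hf Hc; destruct (in_dec coord_eq_dec c l) as [Hi|Hi].
  - now apply lsum_single.
  - rewrite Hc by auto; apply lsum_zero; intros d Hd; apply Hf; congruence.
Qed.

Section Core.

Variables (U : R -> Prop) (A B phi phi1 : R -> R) (b c u0 : R).
Hypothesis HU : is_open_interval U.
Hypothesis HA : forall (n : nat) (y : R), U y -> ex_derive_n A n y.
Hypothesis HA0 : forall y, U y -> A y <> 0.
Hypothesis HA1 : ~ (exists a, forall y, U y -> A y = a).
Hypothesis HA2 : ~ (exists a b, forall y, U y -> y + b <> 0 /\ A y = a / (y + b) ^ 2).
Hypothesis HB : forall y, U y -> is_derive B y (A y).
Hypothesis Hphi : forall x, is_derive phi x (phi1 x).
Hypothesis Hphi1 : forall x, phi1 x = b * phi x - c.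
Hypothesis Hphi0 : forall x, phi1 x <> 0.
Hypothesis Hu0 : U u0.

Notation Om := (u_dom U).
Notation sm := (difffun 3 Om).

(** Eliminating B between the relation and its derivative leaves (e2 + e3 y)^2 A = e0 e3 - e1 e2. If
    e3 <> 0 this is the excluded form a (y + b)^(-2); if e3 = 0 and e2 <> 0 the differentiated
    relation makes A constant. *)
Lemma antiderivative_indep e0 e1 e2 e3 :
  (forall y, U y -> e0 + e1 * y + e2 * B y + e3 * (y * B y) = 0) ->
  e2 = 0 /\ e3 = 0.
Proof.
  intros H.
  assert (H' : forall y, U y -> e1 + e2 * A y + e3 * (B y + y * A y) = 0).
  { intros y Hy.
    assert (E1 : is_derive (fun y => e0 + e1 * y + e2 * B y + e3 * (y * B y)) y
              (e1 + e2 * A y + e3 * (B y + y * A y))).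
    { pose proof (HB y Hy) as HBy; evar_last.
      - apply @is_derive_plus; [apply @is_derive_plus; [apply @is_derive_plus|]|].
        + apply @is_derive_const.
        + apply is_derive_scal, @is_derive_id.
        + apply is_derive_scal, HBy.
        + apply is_derive_scal.
          apply @is_derive_mult; [apply @is_derive_id|exact HBy|intros; apply Rmult_comm].
      - unfold plus, zero, mult, one; simpl; unfold mult, one; simpl; ring. }
    assert (E2 : is_derive (fun y => e0 + e1 * y + e2 * B y + e3 * (y * B y)) y 0).
    { apply (is_derive_ext_loc (fun _ => 0)); [|apply @is_derive_const].
      destruct HU as [_ [Ho _]]; destruct (Ho y Hy) as [r [Hr Hd]].
      exists (mkposreal r Hr); intros w Hw; symmetry; apply H, Hd, Hw. }
    apply is_derive_unique in E1; apply is_derive_unique in E2; lra. }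
  assert (H3 : e3 = 0).
  { destruct (Req_dec e3 0) as [|E3]; auto; exfalso; apply HA2.
    set (k := e0 * e3 - e1 * e2).
    assert (Hk : forall y, U y -> (e2 + e3 * y) * (e2 + e3 * y) * A y = k).
    { intros y Hy; specialize (H y Hy); specialize (H' y Hy); unfold k.
      replace ((e2 + e3 * y) * (e2 + e3 * y) * A y) with
        ((e2 + e3 * y) * ((e1 + e2 * A y + e3 * (B y + y * A y)) - e1)
          - e3 * ((e0 + e1 * y + e2 * B y + e3 * (y * B y)) - e0 - e1 * y)) by ring.
      rewrite H, H'; ring. }
    (* A zero of e2 + e3 y in U would force k = 0; as A does not vanish, e2 + e3 y would then vanish
       at a second point of U as well, contradicting e3 <> 0. *)
    assert (Hn : forall y, U y -> e2 + e3 * y <> 0).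
    { intros y Hy E; assert (k = 0) by (rewrite <- (Hk y Hy), E; ring).
      destruct HU as [_ [Ho _]]; destruct (Ho y Hy) as [r [Hr Hd]].
      assert (Hy' : U (y + r / 2)).
      { apply Hd; replace (y + r / 2 - y) with (r / 2) by ring.
        rewrite Rabs_pos_eq; lra. }
      specialize (Hk _ Hy'); rewrite H0 in Hk.
      apply Rmult_integral in Hk as [Hk|Hk]; [|now apply (HA0 _ Hy')].
      replace (e2 + e3 * (y + r / 2)) with ((e2 + e3 * y) + e3 * (r / 2)) in Hk by ring.
      rewrite E, Rplus_0_l in Hk.
      apply Rmult_integral in Hk as [Hk|Hk]; apply Rmult_integral in Hk as [Hk|Hk]; lra. }
    exists (k / (e3 * e3)), (e2 / e3); intros y Hy.
    specialize (Hn y Hy).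
    assert (Hy0 : y + e2 / e3 <> 0).
    { intros E; apply Hn.
      replace (e2 + e3 * y) with (e3 * (y + e2 / e3)) by (field; auto).
      rewrite E; ring. }
    split; auto; rewrite <- (Hk y Hy).
    field; split; auto.
    replace (y * e3 + e2) with (e2 + e3 * y) by ring; auto. }
  subst e3; split; auto.
  destruct (Req_dec e2 0) as [|E2]; auto; exfalso; apply HA1.
  exists (- e1 / e2); intros y Hy; specialize (H' y Hy).
  apply Rmult_eq_reg_l with e2; auto; replace (e2 * (- e1 / e2)) with (- e1)
    by (field; auto); lra.
Qed.

(** * Smoothness of the coefficient functions *)

Lemma sm_A : sm (fun z => A (z (jc 2))).
Proof.
  apply (sm_fun 3 U HU (fun n y => Derive_n A n y) (jc 2) (valid_s 2)).
  intros n y Hy; apply Derive_correct; apply (HA (S n) y (Hy eq_refl)).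
Qed.

Lemma sm_B : sm (fun z => B (z (jc 2))).
Proof.
  apply (sm_fun 3 U HU (fun n y => match n with O => B y | S n => Derive_n A n y end)
    (jc 2) (valid_s 2)).
  intros [|n] y Hy; [apply HB, (Hy eq_refl)|].
  apply Derive_correct; apply (HA (S n) y (Hy eq_refl)).
Qed.

(** Differentiating phi' = b phi - c gives phi'' = b phi', so all derivatives of phi, phi' and
    1/phi' are explicit geometric sequences. *)
Lemma phi1_derive x : is_derive phi1 x (b * phi1 x).
Proof.
  apply (is_derive_ext (fun x => b * phi x - c)); [intros; now rewrite Hphi1|].
  evar_last.
  - apply @is_derive_minus; [apply is_derive_scal, Hphi|apply @is_derive_const].
  - unfold minus, plus, opp, zero; simpl; ring.
Qed.

Lemma inv_phi1_derive x : is_derive (fun x => / phi1 x) x (- b * / phi1 x).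
Proof.
  evar_last; [apply is_derive_inv; [apply phi1_derive|apply Hphi0]|].
  field; apply Hphi0.
Qed.

Lemma phi1_jet n (y : R) :
  is_derive (fun y => b ^ n * phi1 y) y (b ^ S n * phi1 y).
Proof.
  evar_last; [apply is_derive_scal, phi1_derive|simpl; ring].
Qed.

Lemma sm_phi1 : sm (fun z => phi1 (z Cx)).
Proof.
  replace (fun z : jet => phi1 (z Cx)) with (fun z : jet => b ^ 0 * phi1 (z Cx))
    by (extensionality z; simpl; ring).
  apply (sm_fun 3 U HU (fun n y => b ^ n * phi1 y) Cx (valid_x 3)).
  intros n y _; apply phi1_jet.
Qed.

Lemma sm_phi : sm (fun z => phi (z Cx)).
Proof.
  apply (sm_fun 3 U HU
    (fun n y => match n with O => phi y | S n => b ^ n * phi1 y end) Cx (valid_x 3)).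
  intros [|n] y _; [|apply phi1_jet].
  simpl; rewrite Rmult_1_l; apply Hphi.
Qed.

Lemma sm_inv_phi1 : sm (fun z => / phi1 (z Cx)).
Proof.
  replace (fun z : jet => / phi1 (z Cx)) with (fun z : jet => (- b) ^ 0 * / phi1 (z Cx))
    by (extensionality z; simpl; ring).
  apply (sm_fun 3 U HU (fun n y => (- b) ^ n * / phi1 y) Cx (valid_x 3)).
  intros n y _; evar_last; [apply is_derive_scal, inv_phi1_derive|simpl; ring].
Qed.

(** * The restricted total derivatives and their commutation *)

Definition field_X (d : coord) (z : jet) : R :=
  match d with
  | Cx => 1
  | Cu 0 0 j => z (Cu 0 0 (S j))
  | Cu 1 0 0 => z (jc 2)
  | Cu 2 0 0 => - (phi1 (z Cx) * z (jc 1))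
  | _ => 0
  end.

Definition Dred : (jet -> R) -> jet -> R := op 3 field_X.

Definition flux_P : jet -> R := fun z => A (z (jc 2)) * z (jc 3) + b * B (z (jc 2)).

(** [flux_P] is v^1_t. Since u = v^1_x, the j-th x-derivative of u evolves by D^{j+1} of it, so the
    component at s_{k+1} is D^k [flux_P] for every k. The component at s_0 is phi A u_x + c B - phi
    (A u_x + b B) = - phi' B. *)
Definition field_T (d : coord) (z : jet) : R :=
  match d with
  | Ct => 1
  | Cu 0 0 j => iter_op (S j) Dred flux_P z
  | Cu 1 0 0 => flux_P z
  | Cu 2 0 0 => - (phi1 (z Cx) * B (z (jc 2)))
  | _ => 0
  end.

Definition Tred : (jet -> R) -> jet -> R := op 3 field_T.

Lemma sm_s k : sm (fun z => z (jc k)).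
Proof. apply sm_coord; auto using valid_s. Qed.

Lemma coord_cases d :
  d = Ct \/ d = Cx \/ (exists k, d = jc k) \/ (field_X d = fun _ => 0) /\ (field_T d = fun _ => 0).
Proof.
  destruct d as [| |[|[|[|k]]] [|i] j]; auto; right; right;
    try (right; split; reflexivity).
  - left; now exists (S (S j)).
  - destruct j; [left; now exists 1%nat|right; split; reflexivity].
  - destruct j; [left; now exists 0%nat|right; split; reflexivity].
Qed.

(** The factor in D_x s_k = gam_k s_{k+1}; with it s_0 needs no separate treatment. [igam] is its
    reciprocal. *)
Definition gam (k : nat) (z : jet) : R :=
  match k with O => - phi1 (z Cx) | _ => 1 end.

Definition igam (k : nat) (z : jet) : R :=
  match k with O => - / phi1 (z Cx) | _ => 1 end.

Lemma gam_igam k z : gam k z * igam k z = 1.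
Proof. destruct k; simpl; [field; apply Hphi0|ring]. Qed.

Lemma gam_neq0 k z : gam k z <> 0.
Proof.
  intros E; generalize (gam_igam k z); rewrite E, Rmult_0_l; lra.
Qed.

Lemma sm_gam k : sm (gam k).
Proof.
  destruct k as [|k]; [apply (sm_opp 3 U HU), sm_phi1|apply (sm_const 3 U HU 1)].
Qed.

Lemma sm_igam k : sm (igam k).
Proof.
  destruct k as [|k]; [apply (sm_opp 3 U HU), sm_inv_phi1|apply (sm_const 3 U HU 1)].
Qed.

Lemma X_s k z : field_X (jc k) z = gam k z * z (jc (S k)).
Proof. destruct k as [|[|k]]; simpl; ring. Qed.

Lemma T_s_S k : field_T (jc (S k)) = iter_op k Dred flux_P.
Proof. destruct k as [|k]; reflexivity. Qed.

Lemma sm_X d : sm (field_X d).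
Proof.
  destruct (coord_cases d) as [->|[->|[[k ->]|[-> _]]]];
    try (now apply (sm_const 3 U HU)).
  replace (field_X (jc k)) with (fun z => gam k z * z (jc (S k)))
    by (extensionality z; now rewrite X_s).
  apply (sm_mult 3 U HU); auto using sm_gam, sm_s.
Qed.

Lemma sm_P : sm flux_P.
Proof.
  apply (sm_plus 3 U HU); [apply (sm_mult 3 U HU)|apply (sm_scal 3 U HU)];
    auto using sm_A, sm_B, sm_s.
Qed.

Lemma sm_D f : sm f -> sm (Dred f).
Proof. apply (sm_op 3 U HU field_X sm_X). Qed.

Lemma sm_iterD k f : sm f -> sm (iter_op k Dred f).
Proof. intros Hf; induction k as [|k IH]; simpl; auto using sm_D. Qed.

Lemma sm_T d : sm (field_T d).
Proof.
  destruct (coord_cases d) as [->|[->|[[k ->]|[_ ->]]]];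
    try (now apply (sm_const 3 U HU)).
  destruct k as [|k].
  - apply (sm_opp 3 U HU), (sm_mult 3 U HU); auto using sm_phi1, sm_B.
  - rewrite T_s_S; auto using sm_iterD, sm_P.
Qed.

Lemma sm_Tt f : sm f -> sm (Tred f).
Proof. apply (sm_op 3 U HU field_T sm_T). Qed.

Lemma sm_pd' d f : sm f -> sm (pd d f).
Proof. apply (sm_pd 3 U). Qed.

Lemma D_ext f g z : sm f -> sm g -> (forall y, Om y -> f y = g y) -> Om z ->
  Dred f z = Dred g z.
Proof. apply (op_ext 3 U HU field_X). Qed.

Lemma Tt_ext f g z : sm f -> sm g -> (forall y, Om y -> f y = g y) -> Om z ->
  Tred f z = Tred g z.
Proof. apply (op_ext 3 U HU field_T). Qed.

Lemma D_zero f z : sm f -> (forall y, Om y -> f y = 0) -> Om z -> Dred f z = 0.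
Proof.
  intros Hf H Hz; rewrite (D_ext f (fun _ => 0)); auto.
  - apply (op_const 3).
  - apply (sm_const 3 U HU).
Qed.

Lemma Tt_zero f z : sm f -> (forall y, Om y -> f y = 0) -> Om z -> Tred f z = 0.
Proof.
  intros Hf H Hz; rewrite (Tt_ext f (fun _ => 0)); auto.
  - apply (op_const 3).
  - apply (sm_const 3 U HU).
Qed.

Lemma pd_zero_on d f z : (forall y, Om y -> f y = 0) -> Om z -> pd d f z = 0.
Proof.
  intros H Hz; rewrite (pd_ext_on U HU d f (fun _ => 0)) by auto; apply pd_const.
Qed.

Lemma D_phi z : Om z -> Dred (fun y => phi (y Cx)) z = phi1 (z Cx).
Proof.
  intros Hz; unfold Dred.
  rewrite (op_fun 3 U HU field_X (fun n y => match n with O => phi y | S n => b ^ n * phi1 y end));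
    auto using valid_x; [simpl; ring|].
  intros [|n] y _; [|apply phi1_jet].
  simpl; rewrite Rmult_1_l; apply Hphi.
Qed.

Lemma Tt_phi z : Om z -> Tred (fun y => phi (y Cx)) z = 0.
Proof.
  intros Hz; unfold Tred.
  rewrite (op_fun 3 U HU field_T (fun n y => match n with O => phi y | S n => b ^ n * phi1 y end));
    auto using valid_x; [simpl; ring|].
  intros [|n] y _; [|apply phi1_jet].
  simpl; rewrite Rmult_1_l; apply Hphi.
Qed.

Lemma op_phi1 V z : Om z ->
  op 3 V (fun y => phi1 (y Cx)) z = V Cx z * (b * phi1 (z Cx)).
Proof.
  intros Hz.
  replace (fun y : jet => phi1 (y Cx)) with (fun y : jet => b ^ 0 * phi1 (y Cx))
    by (extensionality y; simpl; ring).
  rewrite (op_fun 3 U HU V (fun n y => b ^ n * phi1 y)); auto using valid_x;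
    [simpl; ring|intros n y _; apply phi1_jet].
Qed.

Lemma D_B z : Om z -> Dred (fun y => B (y (jc 2))) z = A (z (jc 2)) * z (jc 3).
Proof.
  intros Hz; unfold Dred.
  rewrite (op_fun 3 U HU field_X (fun n y => match n with O => B y | S n => Derive_n A n y end));
    auto using valid_s; [simpl; ring|].
  intros [|n] y Hy; [apply HB, (Hy eq_refl)|].
  apply Derive_correct; apply (HA (S n) y (Hy eq_refl)).
Qed.

Lemma D_s k z : Om z -> Dred (fun y => y (jc k)) z = field_X (jc k) z.
Proof. intros Hz; apply (op_coord 3 U HU); auto using valid_s. Qed.

Lemma Tt_s k z : Om z -> Tred (fun y => y (jc k)) z = field_T (jc k) z.
Proof. intros Hz; apply (op_coord 3 U HU); auto using valid_s. Qed.

(** By [op_comm] it suffices to look at coordinates. On s_{k+1} the components of [field_T] are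
    built by iterating D; on s_0 both sides equal - phi' (A s_3 + b B), where phi'' = b phi'
    enters. *)
Lemma Tt_D_comm f z : sm f -> Om z -> Tred (Dred f) z = Dred (Tred f) z.
Proof.
  intros Hf Hz; destruct Hf as [N [HN HS]].
  assert (Hf : sm f) by (exists N; auto).
  unfold Tred, Dred; rewrite (op_comm 3 U HU field_T field_X f N); auto using sm_T, sm_X.
  rewrite lsum_zero; [ring|]; intros d _.
  replace (op 3 field_T (field_X d) z - op 3 field_X (field_T d) z) with 0; [ring|symmetry].
  destruct (coord_cases d) as [->|[->|[[k ->]|[-> ->]]]].
  - change (field_X Ct) with (fun _ : jet => 0); change (field_T Ct) with (fun _ : jet => 1).
    rewrite !op_const; ring.
  - change (field_X Cx) with (fun _ : jet => 1); change (field_T Cx) with (fun _ : jet => 0).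
    rewrite !op_const; ring.
  - destruct k as [|k].
    + change (field_X (jc 0)) with (fun z : jet => - (phi1 (z Cx) * z (jc 1))).
      change (field_T (jc 0)) with (fun z : jet => - (phi1 (z Cx) * B (z (jc 2)))).
      rewrite !(op_opp 3 U HU) by
        (auto; apply (sm_mult 3 U HU); auto using sm_phi1, sm_s, sm_B).
      rewrite !(op_mult 3 U HU) by auto using sm_phi1, sm_s, sm_B.
      rewrite !op_phi1 by auto.
      fold Dred; rewrite D_B by auto; fold Tred; rewrite Tt_s by auto.
      change (field_T Cx z) with 0; change (field_X Cx z) with 1.
      change (field_T (jc 1) z) with (flux_P z).
      unfold flux_P; ring.
    + change (op 3 field_T (field_X (jc (S k))) z) with (Tred (field_X (jc (S k))) z).
      rewrite (Tt_ext _ (fun y => y (jc (S (S k)))));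
        auto using sm_X, sm_s; [|intros y _; rewrite X_s; simpl; ring].
      rewrite Tt_s by auto; rewrite !T_s_S; simpl; fold Dred; ring.
  - rewrite !op_const; ring.
Qed.

(** * Order of a function and its leading derivatives *)

Definition rd (n : nat) (d : coord) : Prop :=
  d = Ct \/ d = Cx \/ exists k, (k <= n)%nat /\ d = jc k.

Notation Rd n f := (depO U (rd n) f).

Lemma rd_s n k : (k <= n)%nat -> rd n (jc k).
Proof. right; right; eauto. Qed.

Lemma rd_t n : rd n Ct.
Proof. left; reflexivity. Qed.

Lemma rd_x n : rd n Cx.
Proof. right; left; reflexivity. Qed.

Lemma not_rd n k : (n < k)%nat -> ~ rd n (jc k).
Proof.
  intros H [E|[E|[j [Hj E]]]].
  - now apply (s_not_t k).
  - now apply (s_not_x k).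
  - apply s_inj in E; lia.
Qed.

Lemma Rd_mono n n' f : (n <= n')%nat -> Rd n f -> Rd n' f.
Proof.
  intros H; apply depO_mono; intros d [?|[?|[k [Hk ?]]]]; unfold rd; auto.
  right; right; exists k; split; auto; lia.
Qed.

Lemma Rd_drop n f : sm f -> Rd (S n) f ->
  (forall z, Om z -> pd (jc (S n)) f z = 0) -> Rd n f.
Proof.
  intros Hf HR H0.
  eapply depO_mono; [|exact (depO_drop 3 U HU _ _ (jc (S n)) Hf HR H0)].
  intros d [[->|[->|[k [Hk ->]]]] Hd]; auto using rd_t, rd_x.
  apply rd_s; assert (k <> S n) by congruence; lia.
Qed.

Lemma pd_above n k f z : Rd n f -> (n < k)%nat -> Om z -> pd (jc k) f z = 0.
Proof. intros Hf Hk; apply (depO_pd_zero U HU (rd n)); auto using not_rd. Qed.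

Lemma Rd_X n d : rd n d -> Rd (S n) (field_X d).
Proof.
  intros [->|[->|[k [Hk ->]]]] z w Hz Hw E; auto.
  rewrite !X_s, (E (jc (S k))) by (apply rd_s; lia).
  f_equal; destruct k; simpl; rewrite ?(E Cx (rd_x _)); reflexivity.
Qed.

Lemma Rd_D n f : sm f -> Rd n f -> Rd (S n) (Dred f).
Proof.
  intros Hf HR; apply (depO_op 3 U HU field_X (rd n)); auto.
  - intros d [?|[?|[k [Hk ?]]]]; unfold rd; auto.
    right; right; exists k; split; auto; lia.
  - apply Rd_X.
Qed.

Lemma Rd_P : Rd 3 flux_P.
Proof.
  intros z w _ _ E; unfold flux_P; now rewrite !(E (jc 2)), (E (jc 3)) by (apply rd_s; lia).
Qed.

Lemma Rd_iterD k : Rd (k + 3) (iter_op k Dred flux_P).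
Proof.
  induction k as [|k IH]; simpl; [exact Rd_P|].
  apply Rd_D; auto using sm_iterD, sm_P.
Qed.

Lemma Rd_T k : Rd (k + 2) (field_T (jc k)).
Proof.
  destruct k as [|k].
  - intros z w _ _ E;
    change (- (phi1 (z Cx) * B (z (jc 2))) = - (phi1 (w Cx) * B (w (jc 2)))).
    now rewrite (E Cx), (E (jc 2)) by (auto using rd_x, rd_s).
  - rewrite T_s_S; replace (S k + 2)%nat with (k + 3)%nat by lia; apply Rd_iterD.
Qed.

Lemma Rd_Tt n f : sm f -> Rd n f -> Rd (n + 2) (Tred f).
Proof.
  intros Hf HR; apply (depO_op 3 U HU field_T (rd n)); auto.
  - intros d [?|[?|[k [Hk ?]]]]; unfold rd; auto.
    right; right; exists k; split; auto; lia.
  - intros d [->|[->|[k [Hk ->]]]]; [now intros z w _ _ _..|].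
    apply (Rd_mono (k + 2)); [lia|apply Rd_T].
Qed.

(** Among the components of [field_X] only the one at s_k contains s_{k+1}, with coefficient gam_k.
    For f of order k the first term on the right vanishes, leaving the leading coefficient of D
    f. *)
Lemma pd_D k f z : sm f -> Om z ->
  pd (jc (S k)) (Dred f) z = Dred (pd (jc (S k)) f) z + gam k z * pd (jc k) f z.
Proof.
  intros Hf Hz; destruct Hf as [N [HN HS]].
  assert (Hf : sm f) by (exists N; auto).
  unfold Dred; rewrite (pd_op 3 U HU field_X sm_X f N) by auto; f_equal.
  rewrite (lsum_single' _ (jc k)); auto using NoDup_coords.
  - f_equal.
    rewrite (pd_ext_on U HU _ (field_X (jc k)) (fun y => gam k y * y (jc (S k))));
      [|intros; apply X_s|auto].
    rewrite (pd_mult 3 U) by auto using sm_gam, sm_s.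
    rewrite pd_coord.
    rewrite (dep_pd_zero (fun e => e = Cx) (gam k)); [ring| |apply s_not_x].
    intros x y E; destruct k; simpl; now rewrite ?E.
  - intros d Hd; replace (pd (jc (S k)) (field_X d) z) with 0; [ring|symmetry].
    destruct (coord_cases d) as [->|[->|[[j ->]|[-> _]]]];
      try (apply (dep_pd_zero (fun _ => False)); [intros x y _; reflexivity|tauto]).
    apply (dep_pd_zero (fun e => e = Cx \/ e = jc (S j))).
    + intros x y E; rewrite !X_s, (E (jc (S j))) by auto; f_equal.
      destruct j; simpl; now rewrite ?(E Cx) by auto.
    + intros [E|E]; [now apply (s_not_x (S k))|].
      apply s_inj in E; apply Hd; f_equal; lia.
  - intros Hi; rewrite (pd_out 3 f N) by auto; ring.
Qed.

(** Each further D shifts the leading coordinate by one with factor 1, so the leading coefficient A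
    of [flux_P] persists. *)
Lemma T_top k z : Om z -> pd (jc (k + 3)) (field_T (jc (S k))) z = A (z (jc 2)).
Proof.
  revert z; induction k as [|k IH]; intros z Hz.
  - change (field_T (jc 1)) with (fun z : jet => A (z (jc 2)) * z (jc 3) + b * B (z (jc 2))).
    simpl (0 + 3)%nat.
    rewrite (pd_plus 3 U), (pd_mult 3 U), (pd_scal 3 U HU), pd_coord,
      (pd_fun_other A), (pd_fun_other B); auto using sm_A, sm_B, sm_s;
      try discriminate; [ring|apply (sm_mult 3 U HU)|apply (sm_scal 3 U HU)];
      auto using sm_A, sm_B, sm_s.
  - rewrite T_s_S; change (iter_op (S k) Dred flux_P) with (Dred (iter_op k Dred flux_P)).
    rewrite <- T_s_S; change (S k + 3)%nat with (S (k + 3)).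
    rewrite pd_D, IH by auto using sm_T.
    replace (k + 3)%nat with (S (k + 2)) by lia; cbn [gam].
    rewrite D_zero; [ring|auto using sm_pd', sm_T| |auto].
    intros y Hy; apply (pd_above (S k + 2)); auto using Rd_T; lia.
Qed.

(** As f has order below k, only the components of [field_T] can be differentiated with respect to
    s_k. *)
Lemma pd_Tt_sum n k f z : sm f -> Rd n f -> (n < k)%nat -> Om z ->
  pd (jc k) (Tred f) z = lsum (map jc (seq 0 (S n))) (fun d => pd (jc k) (field_T d) z * pd d f z).
Proof.
  intros Hf HR Hk Hz; destruct Hf as [N [HN HS]].
  assert (Hf : sm f) by (exists N; auto).
  unfold Tred; rewrite (pd_op 3 U HU field_T sm_T f N) by auto.
  change (op 3 field_T (pd (jc k) f) z) with (Tred (pd (jc k) f) z).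
  rewrite Tt_zero, Rplus_0_l; auto using sm_pd'.
  2: { intros y Hy; now apply (pd_above n). }
  apply lsum_support; auto using NoDup_coords.
  - apply Injective_map_NoDup; [intros i j; apply s_inj|apply seq_NoDup].
  - intros d _ Hd; destruct (classic (rd n d)) as [[->|[->|[j [Hj ->]]]]|H].
    + rewrite (dep_pd_zero (fun _ => False) (field_T Ct)); [ring| |tauto].
      intros x y _; reflexivity.
    + rewrite (dep_pd_zero (fun _ => False) (field_T Cx)); [ring| |tauto].
      intros x y _; reflexivity.
    + exfalso; apply Hd, in_map, in_seq; lia.
    + rewrite (depO_pd_zero U HU (rd n) f) by auto; ring.
  - intros d _ Hd; rewrite (pd_out 3 f N) by auto; ring.
Qed.

Lemma pd_T_above j k z : (j + 2 < k)%nat -> Om z -> pd (jc k) (field_T (jc j)) z = 0.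
Proof. intros H Hz; apply (pd_above (j + 2)); auto using Rd_T. Qed.

Lemma pd_Tt_top n f z : sm f -> Rd (S n) f -> Om z ->
  pd (jc (n + 3)) (Tred f) z = A (z (jc 2)) * pd (jc (S n)) f z.
Proof.
  intros Hf HR Hz; rewrite (pd_Tt_sum (S n)) by (auto; lia).
  rewrite seq_S, map_app, lsum_app, lsum_zero.
  - cbn [lsum fold_right map]; rewrite T_top by auto; rewrite ?Nat.add_0_l; ring.
  - intros d Hd; apply in_map_iff in Hd as [j [<- Hj]]; apply in_seq in Hj.
    rewrite pd_T_above by (auto; lia); ring.
Qed.

(** Here T f has order n + 4, and s_{n+3} is one step below the top: the two highest components of
    the field contribute. *)
Lemma pd_Tt_next n f z : sm f -> Rd (S (S n)) f -> Om z ->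
  pd (jc (n + 3)) (Tred f) z =
    A (z (jc 2)) * pd (jc (S n)) f z
    + pd (jc (n + 3)) (field_T (jc (S (S n)))) z * pd (jc (S (S n))) f z.
Proof.
  intros Hf HR Hz; rewrite (pd_Tt_sum (S (S n))) by (auto; lia).
  rewrite seq_S, map_app, lsum_app, seq_S, map_app, lsum_app, lsum_zero.
  - cbn [lsum fold_right map]; rewrite T_top by auto; rewrite ?Nat.add_0_l; ring.
  - intros d Hd; apply in_map_iff in Hd as [j [<- Hj]]; apply in_seq in Hj.
    rewrite pd_T_above by (auto; lia); ring.
Qed.

(** Q is affine in s_{n+2} with slope q. The first derivative of D Q is D q + Q_{s_{n+1}}, and
    differentiating once more each summand yields q_{s_{n+1}}. *)
Lemma pd2_D n Q q z : sm Q -> sm q -> Rd (S n) q ->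
  (forall y, Om y -> pd (jc (S (S n))) Q y = q y) -> Om z ->
  pd (jc (S (S n))) (pd (jc (S (S n))) (Dred Q)) z = 2 * pd (jc (S n)) q z.
Proof.
  intros HQ Hq HR E Hz.
  rewrite (pd_ext_on U HU _ _ (fun y => Dred q y + pd (jc (S n)) Q y)).
  - rewrite (pd_plus 3 U) by auto using sm_D, sm_pd'.
    rewrite pd_D, D_zero by (auto using sm_pd'; intros; apply (pd_above (S n)); auto).
    rewrite (sm_pd_comm 3 U HU Q) by auto.
    rewrite (pd_ext_on U HU _ (pd (jc (S (S n))) Q) q) by auto; simpl; ring.
  - intros y Hy; rewrite pd_D by auto; cbn [gam].
    rewrite (D_ext _ q) by auto using sm_pd'; ring.
  - auto.
Qed.

(** * What the balance equation forces on flux and density *)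

Definition balance (F G : jet -> R) : Prop :=
  forall z, Om z -> Tred F z + Dred G z = 0.

Lemma pd_balance F G k z : sm F -> sm G -> balance F G -> Om z ->
  pd (jc k) (Tred F) z + pd (jc k) (Dred G) z = 0.
Proof.
  intros HF HG HE Hz; rewrite <- (pd_plus 3 U) by auto using sm_Tt, sm_D.
  apply pd_zero_on; auto.
Qed.

(** T F has order n + 2, so if G had order above n + 1 the leading term of D G could not be
    balanced; p counts the excess to be removed. *)
Lemma flux_order n F G : sm F -> sm G -> balance F G -> Rd n F ->
  forall p, Rd (n + 1 + p) G -> Rd (n + 1) G.
Proof.
  intros HF HG HE HRF; induction p as [|p IH]; intros HR.
  - now rewrite Nat.add_0_r in HR.
  - apply IH; rewrite Nat.add_succ_r in HR; apply Rd_drop; auto; intros z Hz.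
    generalize (pd_balance F G (S (S (n + 1 + p))) z HF HG HE Hz).
    rewrite pd_D, (pd_above (n + 2) _ (Tred F)), D_zero; auto using sm_pd', Rd_Tt.
    + intros E; cbn [gam] in E; lra.
    + intros y Hy; apply (pd_above (S (n + 1 + p))); auto.
    + lia.
Qed.

Lemma flux_top n F G z : sm F -> sm G -> balance F G -> Rd (S n) F -> Rd (S (S n)) G ->
  Om z -> pd (jc (S (S n))) G z = - (A (z (jc 2)) * pd (jc (S n)) F z).
Proof.
  intros HF HG HE HRF HRG Hz.
  generalize (pd_balance F G (n + 3) z HF HG HE Hz).
  rewrite pd_Tt_top by auto.
  replace (n + 3)%nat with (S (S (S n))) by lia.
  rewrite pd_D, D_zero; auto using sm_pd'.
  - cbn [gam]; lra.
  - intros y Hy; apply (pd_above (S (S n))); auto.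
Qed.

(** Write N = n + 2. The second derivative of the balance equation in s_{N+1} is 2 A_{s_N} F_{s_N} -
    2 (A F_{s_N})_{s_N} = 0: the derivatives of A cancel and A F_{s_N s_N} = 0 remains. *)
Lemma density_affine_high n F G z : sm F -> sm G -> balance F G ->
  Rd (S (S n)) F -> Rd (S (S (S n))) G -> Om z ->
  pd (jc (S (S n))) (pd (jc (S (S n))) F) z = 0.
Proof.
  intros HF HG HE HRF HRG Hz.
  set (e := jc (S (S (S n)))); set (Fn := pd (jc (S (S n))) F).
  assert (HFn : sm Fn) by (now apply sm_pd').
  assert (HRFn : Rd (S (S n)) Fn) by (now apply (depO_pd U HU)).
  set (a := fun y : jet => A (y (jc 2))).
  assert (Ha : sm a) by apply sm_A.
  (* The density has order at least 2, so u is among s_0, ..., s_{n+2} and A is constant in the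
     direction [e]. *)
  assert (HRa : Rd (S (S n)) a).
  { intros x y _ _ E; unfold a; rewrite (E (jc 2)); auto; apply rd_s; lia. }
  assert (E1 : pd e (pd e (Dred G)) z = 2 * pd (jc (S (S n))) (fun y => - (a y * Fn y)) z).
  { apply pd2_D; auto.
    - apply (sm_opp 3 U HU), (sm_mult 3 U HU); auto.
    - intros x y Hx Hy E; now rewrite (HRa x y), (HRFn x y).
    - intros y Hy; apply flux_top; auto. }
  assert (E2 : pd e (pd e (field_T (jc (S (S n))))) z = 2 * pd (jc (S (S n))) a z).
  { rewrite T_s_S; change (iter_op (S n) Dred flux_P) with (Dred (iter_op n Dred flux_P)).
    rewrite <- T_s_S; apply pd2_D; auto using sm_T.
    intros y Hy; unfold e; replace (S (S (S n))) with (n + 3)%nat by lia.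
    now apply T_top. }
  assert (E3 : pd e (pd e (Tred F)) z = pd e (pd e (field_T (jc (S (S n))))) z * Fn z).
  { rewrite (pd_ext_on U HU e _ (fun y => a y * pd (jc (S n)) F y +
      pd e (field_T (jc (S (S n)))) y * Fn y)); auto.
    - assert (S1 : sm (pd (jc (S n)) F)) by now apply sm_pd'.
      assert (S2 : sm (pd e (field_T (jc (S (S n)))))) by auto using sm_pd', sm_T.
      rewrite (pd_plus 3 U), !(pd_mult 3 U); auto;
        try (now apply (sm_mult 3 U HU)).
      assert (Ha' : pd e a z = 0) by (apply (pd_above (S (S n))); auto).
      assert (HFn' : pd e Fn z = 0) by (apply (pd_above (S (S n))); auto).
      assert (H1 : pd e (pd (jc (S n)) F) z = 0)
        by (apply (pd_above (S (S n))); auto; now apply (depO_pd U HU)).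
      rewrite Ha', HFn', H1; ring.
    - intros y Hy; unfold e; replace (S (S (S n))) with (n + 3)%nat by lia.
      now apply pd_Tt_next. }
  assert (E0 : pd e (pd e (Tred F)) z + pd e (pd e (Dred G)) z = 0).
  { rewrite <- (pd_plus 3 U) by auto using sm_pd', sm_Tt, sm_D.
    apply pd_zero_on; auto; intros y Hy; apply pd_balance; auto. }
  rewrite E1, E3, E2, (pd_opp 3 U), (pd_mult 3 U) in E0; auto;
    try (now apply (sm_mult 3 U HU)).
  assert (E4 : 2 * A (z (jc 2)) * pd (jc (S (S n))) Fn z = 0) by (unfold a in *; lra).
  apply Rmult_integral in E4 as [E4|E4]; auto.
  exfalso; apply (HA0 (z (jc 2))); [exact Hz|lra].
Qed.

Lemma D_low f z : sm f -> Rd 1 f -> Om z ->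
  Dred f z = pd Cx f z - phi1 (z Cx) * z (jc 1) * pd (jc 0) f z + z (jc 2) * pd (jc 1) f z.
Proof.
  intros Hf HR Hz; unfold Dred; rewrite (op_list 3 U field_X f [Cx; jc 0; jc 1]); auto.
  - simpl; ring.
  - repeat constructor; simpl; intuition discriminate.
  - intros d Hd; destruct (classic (rd 1 d)) as [[->|[->|[k [Hk ->]]]]|H].
    + simpl; ring.
    + exfalso; apply Hd; simpl; auto.
    + exfalso; apply Hd; destruct k as [|[|k]]; simpl; auto; lia.
    + rewrite (depO_pd_zero U HU (rd 1) f) by auto; ring.
Qed.

Lemma Tt_low f z : sm f -> Rd 1 f -> Om z ->
  Tred f z = pd Ct f z - phi1 (z Cx) * B (z (jc 2)) * pd (jc 0) f z + flux_P z * pd (jc 1) f z.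
Proof.
  intros Hf HR Hz; unfold Tred; rewrite (op_list 3 U field_T f [Ct; jc 0; jc 1]); auto.
  - simpl; ring.
  - repeat constructor; simpl; intuition discriminate.
  - intros d Hd; destruct (classic (rd 1 d)) as [[->|[->|[k [Hk ->]]]]|H].
    + exfalso; apply Hd; simpl; auto.
    + simpl; ring.
    + exfalso; apply Hd; destruct k as [|[|k]]; simpl; auto; lia.
    + rewrite (depO_pd_zero U HU (rd 1) f) by auto; ring.
Qed.

(* The equation is an identity in u between functions of the remaining
   coordinates; 1, u, B(u), u B(u) being independent, each coefficient vanishes. *)
Lemma density_low F G : sm F -> sm G -> balance F G -> Rd 1 F -> Rd 2 G ->
  forall z, Om z ->
    - phi1 (z Cx) * pd (jc 0) F z + b * pd (jc 1) F z - pd Cx (pd (jc 1) F) z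
      + phi1 (z Cx) * z (jc 1) * pd (jc 0) (pd (jc 1) F) z = 0 /\
    pd (jc 1) (pd (jc 1) F) z = 0.
Proof.
  intros HF HG HE HRF HRG.
  set (F1 := pd (jc 1) F).
  assert (HF1 : sm F1) by now apply sm_pd'.
  assert (HRF1 : Rd 1 F1) by now apply (depO_pd U HU).
  (* Since G_{s_2} = - A F_{s_1} and B' = A, adding B F_{s_1} removes u from the flux. *)
  set (g := fun y => G y + B (y (jc 2)) * F1 y).
  assert (HBF : sm (fun y => B (y (jc 2)) * F1 y))
    by (apply (sm_mult 3 U HU); auto using sm_B).
  assert (Hg : sm g) by now apply (sm_plus 3 U HU).
  assert (HRg : Rd 1 g).
  { apply Rd_drop; auto.
    - intros x y Hx Hy E; unfold g.
      rewrite (HRG x y), (E (jc 2)), (Rd_mono 1 2 F1 ltac:(lia) HRF1 x y);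
        auto; apply rd_s; lia.
    - intros y Hy; unfold g.
      rewrite (pd_plus 3 U), (pd_mult 3 U); auto using sm_B.
      rewrite (flux_top 0 F G) by auto.
      rewrite (pd_fun U B A); [|intros _; exact Hy|apply HB; exact Hy].
      rewrite (pd_above 1 2 F1) by auto; fold F1; ring. }
  intros z Hz.
  assert (HD : forall y, Om y -> Dred G y = Dred g y - (A (y (jc 2)) * y (jc 3) * F1 y
              + B (y (jc 2)) * Dred F1 y)).
  { intros y Hy.
    rewrite (D_ext G (fun y => g y - B (y (jc 2)) * F1 y)); auto.
    - unfold Dred at 1; rewrite (op_minus 3 U HU), (op_mult 3 U HU) by auto using sm_B.
      fold Dred; now rewrite D_B by auto.
    - apply (sm_minus 3 U HU); auto.
    - intros x _; unfold g; ring. }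
  assert (Hind : forall y, U y ->
     (pd Ct F z + pd Cx g z - phi1 (z Cx) * z (jc 1) * pd (jc 0) g z)
     + pd (jc 1) g z * y
     + (- phi1 (z Cx) * pd (jc 0) F z + b * F1 z - pd Cx F1 z
        + phi1 (z Cx) * z (jc 1) * pd (jc 0) F1 z) * B y
     + - pd (jc 1) F1 z * (y * B y) = 0).
  { intros y Hy; set (w := upd z (jc 2) y).
    assert (Hw : Om w) by (apply Om_upd; auto; intros _; exact Hy).
    assert (Ew : forall f, Rd 1 f -> f z = f w).
    { intros f Hf; apply Hf; auto; intros d Hd; symmetry; apply upd_other.
      intros ->; revert Hd; apply not_rd; lia. }
    assert (E2 : w (jc 2) = y) by apply upd_same.
    assert (Ex : w Cx = z Cx) by (apply upd_other; discriminate).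
    assert (E1 : w (jc 1) = z (jc 1)) by (apply upd_other; discriminate).
    generalize (HE w Hw).
    (* The terms A s_3 F_{s_1} of T F and D G cancel. What is left besides u and B has order at most
       1, hence the same value at [z] and [w]. *)
    rewrite HD, !D_low, Tt_low by auto; unfold flux_P; fold F1.
    rewrite E2, Ex, E1.
    rewrite <- !(Ew F1), <- !(Ew (pd _ F)), <- !(Ew (pd _ g)), <- !(Ew (pd _ F1))
      by (auto; now apply (depO_pd U HU)).
    intros E; rewrite <- E; ring. }
  destruct (antiderivative_indep _ _ _ _ Hind) as [H1 H2]; split; lra.
Qed.

Lemma density_affine n F G z : sm F -> sm G -> balance F G ->
  Rd (S n) F -> Rd (S (S n)) G -> Om z -> pd (jc (S n)) (pd (jc (S n)) F) z = 0.
Proof.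
  destruct n as [|n]; intros HF HG HE HRF HRG Hz.
  - now apply (density_low F G).
  - now apply (density_affine_high n F G).
Qed.

(** * Exactness: lowering the order of the density *)

Lemma dom_u0 d : dom U d u0.
Proof. intros _; exact Hu0. Qed.

(* [igam] compensates the factor - phi' in D_x s_0 = - phi' s_1. *)
Lemma density_reduce n F : sm F -> Rd (S n) F ->
  (forall z, Om z -> pd (jc (S n)) (pd (jc (S n)) F) z = 0) ->
  exists H, sm H /\ Rd n H /\ Rd n (fun z => F z - Dred H z).
Proof.
  intros HF HR H0; set (f := fun z => pd (jc (S n)) F z * igam n z).
  assert (Hf : sm f) by (apply (sm_mult 3 U HU); auto using sm_pd', sm_igam).
  assert (HRf : Rd n f).
  { intros x y Hx Hy E; unfold f; f_equal.
    - revert x y Hx Hy E; apply Rd_drop; auto using sm_pd'; now apply (depO_pd U HU).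
    - destruct n; simpl; now rewrite ?(E Cx (rd_x _)). }
  (* For n = 2 the integration variable is u, so the base point is taken in U. *)
  assert (HH : sm (prim (jc n) u0 f))
    by (apply (sm_prim 3 U HU); auto using valid_s, dom_u0).
  assert (HRH : Rd n (prim (jc n) u0 f))
    by (apply (depO_prim U HU); auto using dom_u0, rd_s).
  exists (prim (jc n) u0 f); split; [|split]; auto.
  assert (HDH : sm (Dred (prim (jc n) u0 f))) by now apply sm_D.
  apply Rd_drop.
  - apply (sm_minus 3 U HU); auto.
  - intros x y Hx Hy E; now rewrite (HR x y), (Rd_D n (prim (jc n) u0 f) HH HRH x y).
  - intros z Hz; rewrite (pd_minus 3 U), pd_D by auto.
    rewrite D_zero; auto using sm_pd'.
    + destruct Hf as [N [_ HfN]].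
      assert (HV := valid_s n); destruct HV as [M HM].
      rewrite (pd_prim 3 U HU (max M N) (jc n) u0); auto using dom_u0.
      * unfold f; generalize (gam_igam n z); intros Eg.
        transitivity (pd (jc (S n)) F z - pd (jc (S n)) F z * (gam n z * igam n z));
          [ring|rewrite Eg; ring].
      * eapply smooth_on_mono; [|exact HfN]; lia.
    + intros y Hy; apply (pd_above n); auto.
Qed.

Lemma sm_prim_pd d f z : valid 3 d -> sm f -> Om z -> pd d (prim d u0 f) z = f z.
Proof.
  intros [M HM] [N [_ Hf]] Hz.
  apply (pd_prim 3 U HU (max M N)); auto using dom_u0.
  eapply smooth_on_mono; [|exact Hf]; lia.
Qed.

(** If G_{s_{k+1}} = 0, then differentiating D G = 0 in s_{k+1} leaves gam_k G_{s_k} = 0. Descending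
    removes every s_k, the last one because phi' <> 0, and then D G = G_x removes x. *)
Lemma flux_constant G p : sm G -> Rd p G -> (forall z, Om z -> Dred G z = 0) ->
  depO U (fun d => d = Ct) G.
Proof.
  intros HG HR HD.
  assert (Hstep : forall k, (forall z, Om z -> pd (jc (S k)) G z = 0) ->
            forall z, Om z -> pd (jc k) G z = 0).
  { intros k Hk z Hz.
    assert (E : pd (jc (S k)) (Dred G) z = 0) by now apply pd_zero_on.
    rewrite pd_D, D_zero, Rplus_0_l in E by auto using sm_pd'.
    apply Rmult_integral in E as [E|E]; auto; now apply gam_neq0 in E. }
  assert (HR0 : Rd 0 G).
  { induction p as [|p IH]; auto; apply IH, Rd_drop; auto.
    apply Hstep; intros z Hz; apply (pd_above (S p)); auto. }
  assert (H0 : forall z, Om z -> pd (jc 0) G z = 0)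
    by (apply Hstep; intros z Hz; apply (pd_above 0); auto).
  assert (Hx : forall z, Om z -> pd Cx G z = 0).
  { intros z Hz; generalize (HD z Hz).
    rewrite D_low; auto; [|apply (Rd_mono 0); auto].
    rewrite H0, (pd_above 0 1 G) by auto; lra. }
  generalize (depO_drop 3 U HU _ G Cx HG (depO_drop 3 U HU _ G (jc 0) HG HR0 H0) Hx).
  apply depO_mono; intros d [[[?|[?|[k [Hk ?]]]] H1] H2]; try tauto.
  replace k with 0%nat in * by lia; tauto.
Qed.

(** [density_low] with F_{s_1} = 0 gives phi' F_{s_0} = 0, so F is a function of t and x, with
    x-primitive H0. The corrected flux G + T H0 lies in the kernel of D, hence depends on t only;
    its t-primitive K makes H0 - K the potential for both components. *)
Lemma exact_order0 F G p : sm F -> sm G -> balance F G -> Rd 0 F -> Rd p G ->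
  exists H, sm H /\ (exists q, Rd q H) /\
    forall z, Om z -> Dred H z = F z /\ Tred H z = - G z.
Proof.
  intros HF HG HE HRF HRG.
  assert (HRF1 : Rd 1 F) by (apply (Rd_mono 0); auto).
  assert (HRG2 : Rd 2 G).
  { apply (flux_order 1 F G HF HG HE HRF1 p); apply (Rd_mono p); auto; lia. }
  assert (HF1 : forall z, Om z -> pd (jc 1) F z = 0)
    by (intros; apply (pd_above 0); auto).
  assert (HF0 : forall z, Om z -> pd (jc 0) F z = 0).
  { intros z Hz; destruct (density_low F G HF HG HE HRF1 HRG2 z Hz) as [E _].
    rewrite HF1, !(pd_zero_on _ (pd (jc 1) F)) in E by auto.
    assert (E' : phi1 (z Cx) * pd (jc 0) F z = 0) by lra.
    apply Rmult_integral in E' as [E'|E']; auto; now apply Hphi0 in E'. }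
  assert (Htx : depO U (fun d => d = Ct \/ d = Cx) F).
  { generalize (depO_drop 3 U HU _ F (jc 0) HF HRF HF0); apply depO_mono.
    intros d [[?|[?|[k [Hk ?]]]] H1]; auto.
    replace k with 0%nat in * by lia; tauto. }
  set (H0 := prim Cx u0 F).
  assert (HH0 : sm H0) by (apply (sm_prim 3 U HU); auto using valid_x, dom_u0).
  assert (HRH0 : depO U (fun d => d = Ct \/ d = Cx) H0)
    by (apply (depO_prim U HU); auto using dom_u0).
  assert (HR0 : Rd 0 H0).
  { revert HRH0; apply depO_mono; intros d [->| ->]; auto using rd_t, rd_x. }
  assert (Hsn : forall k f z, depO U (fun d => d = Ct \/ d = Cx) f -> Om z ->
            pd (jc k) f z = 0).
  { intros k f z Hf Hz; apply (depO_pd_zero U HU _ _ _ _ Hf); auto.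
    intros [E|E]; [now apply s_not_t in E|now apply s_not_x in E]. }
  assert (HDH0 : forall z, Om z -> Dred H0 z = F z).
  { intros z Hz; rewrite D_low by (auto; apply (Rd_mono 0); auto).
    rewrite !Hsn by auto; unfold H0; rewrite sm_prim_pd by auto using valid_x; ring. }
  set (G' := fun z => G z + Tred H0 z).
  assert (HG' : sm G') by (apply (sm_plus 3 U HU); auto using sm_Tt).
  assert (HRG' : Rd (max p 2) G').
  { intros x y Hx Hy E; unfold G'; f_equal.
    - revert x y Hx Hy E; apply (Rd_mono p); auto; lia.
    - revert x y Hx Hy E; apply (Rd_mono 2); [lia|apply (Rd_Tt 0); auto]. }
  assert (HDG' : forall z, Om z -> Dred G' z = 0).
  { intros z Hz; unfold Dred, G'; rewrite (op_plus 3 U HU) by auto using sm_Tt.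
    fold Dred; rewrite <- Tt_D_comm by auto.
    rewrite (Tt_ext (Dred H0) F) by auto using sm_D.
    rewrite Rplus_comm; auto. }
  assert (Ht := flux_constant G' _ HG' HRG' HDG').
  set (K := prim Ct u0 G').
  assert (HK : sm K) by (apply (sm_prim 3 U HU); auto using valid_t, dom_u0).
  assert (HRK : depO U (fun d => d = Ct) K)
    by (apply (depO_prim U HU); auto using dom_u0).
  assert (HR0K : Rd 0 K).
  { revert HRK; apply depO_mono; intros d ->; apply rd_t. }
  assert (HKz : forall d z, d <> Ct -> Om z -> pd d K z = 0)
    by (intros; apply (depO_pd_zero U HU _ _ _ _ HRK); auto).
  exists (fun z => H0 z - K z); split; [now apply (sm_minus 3 U HU)|split].
  - exists 0%nat; intros x y Hx Hy E; now rewrite (HR0 x y), (HR0K x y).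
  - intros z Hz; unfold Dred, Tred; rewrite !(op_minus 3 U HU) by auto.
    fold Dred; fold Tred.
    rewrite HDH0 by auto.
    rewrite (D_low K), (Tt_low K) by (auto; apply (Rd_mono 0); auto).
    rewrite (HKz Cx), (HKz (jc 0)), (HKz (jc 1)) by (auto; discriminate).
    unfold K at 1; rewrite sm_prim_pd by auto using valid_t.
    unfold G'; split; ring.
Qed.

(** Replacing (F, G) by (F - D H1, G + T H1) preserves the balance because T and D commute; with H1
    from [density_reduce] it lowers the order of F by one. *)
Theorem exactness n : forall F G p, sm F -> sm G -> balance F G -> Rd n F -> Rd p G ->
  exists H, sm H /\ (exists q, Rd q H) /\
    forall z, Om z -> Dred H z = F z /\ Tred H z = - G z.
Proof.
  induction n as [|n IH]; intros F G p HF HG HE HRF HRG.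
  - now apply (exact_order0 F G p).
  - assert (HRG2 : Rd (S (S n)) G).
    { replace (S (S n)) with (S n + 1)%nat by lia.
      apply (flux_order (S n) F G HF HG HE HRF p); apply (Rd_mono p); auto; lia. }
    destruct (density_reduce n F HF HRF) as [H1 [HH1 [HR1 HRF']]].
    { intros z Hz; now apply (density_affine n F G). }
    assert (HTH : sm (Tred H1)) by now apply sm_Tt.
    assert (HDH : sm (Dred H1)) by now apply sm_D.
    destruct (IH (fun z => F z - Dred H1 z) (fun z => G z + Tred H1 z) (max p (n + 2)))
      as [H2 [HH2 [[q HR2] HE2]]].
    + now apply (sm_minus 3 U HU).
    + now apply (sm_plus 3 U HU).
    + intros z Hz; unfold Tred at 1, Dred at 2.
      rewrite (op_minus 3 U HU), (op_plus 3 U HU) by auto.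
      fold Dred; fold Tred; rewrite Tt_D_comm by auto; rewrite <- (HE z Hz); ring.
    + exact HRF'.
    + intros x y Hx Hy E; f_equal.
      * revert x y Hx Hy E; apply (Rd_mono p); auto; lia.
      * revert x y Hx Hy E; apply (Rd_mono (n + 2)); [lia|apply Rd_Tt; auto].
    + exists (fun z => H1 z + H2 z); split; [now apply (sm_plus 3 U HU)|split].
      * exists (max n q); intros x y Hx Hy E; f_equal.
        -- revert x y Hx Hy E; apply (Rd_mono n); auto; lia.
        -- revert x y Hx Hy E; apply (Rd_mono q); auto; lia.
      * intros z Hz; destruct (HE2 z Hz) as [E1 E2].
        unfold Dred, Tred; rewrite !(op_plus 3 U HU) by auto; fold Dred; fold Tred.
        rewrite E1, E2; split; ring.
Qed.

(** * Transfer to the solution set *)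

Definition sigma0 (k : nat) : jet -> R :=
  match k with
  | O => fun z => z (jc 2)
  | 1%nat => fun z => z (jc 1)
  | 2%nat => fun z => z (jc 0) + phi (z Cx) * z (jc 1)
  | _ => fun _ => 0
  end.

(* [sigma] parametrizes the solution set by the coordinates of the restricted
   problem, and [tau] reads these coordinates off a jet. *)
Definition sigma (z : jet) : jet := fun d =>
  match d with
  | Ct => z Ct
  | Cx => z Cx
  | Cu k i j => iter_op i Tred (iter_op j Dred (sigma0 k)) z
  end.

Definition tau (z : jet) : jet :=
  upd z (jc 0) (z (jc 0) - phi (z Cx) * z (jc 1)).

Lemma sm_sigma0 k : sm (sigma0 k).
Proof.
  destruct k as [|[|[|k]]].
  - apply (sm_s 2).
  - apply (sm_s 1).
  - apply (sm_plus 3 U HU); [apply sm_s|].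
    apply (sm_mult 3 U HU); auto using sm_phi, sm_s.
  - apply (sm_const 3 U HU).
Qed.

Lemma sm_iterT k f : sm f -> sm (iter_op k Tred f).
Proof. intros Hf; induction k as [|k IH]; simpl; auto using sm_Tt. Qed.

Lemma sm_sigma d : sm (fun z => sigma z d).
Proof.
  destruct d as [| |k i j]; simpl.
  - apply (sm_coord 3 U HU), valid_t.
  - apply (sm_coord 3 U HU), valid_x.
  - apply sm_iterT, sm_iterD, sm_sigma0.
Qed.

Lemma Om_sigma z : Om z -> Om (sigma z).
Proof. auto. Qed.

Lemma D_iterT k f z : sm f -> Om z -> Dred (iter_op k Tred f) z = iter_op k Tred (Dred f) z.
Proof.
  intros Hf; revert z; induction k as [|k IH]; intros z Hz; simpl; auto.
  rewrite <- Tt_D_comm by auto using sm_iterT.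
  apply Tt_ext; auto using sm_iterT, sm_D.
Qed.

(** [sigma] carries the restricted D to the full x-derivative: D must pass the outer powers of T,
    which is where commutation is needed. For T the analogue holds by construction. *)
Lemma D_sigma d z : Om z -> Dred (fun y => sigma y d) z = field_x d (sigma z).
Proof.
  intros Hz; destruct d as [| |k i j]; simpl.
  - apply (op_coord 3 U HU field_X Ct); auto using valid_t.
  - apply (op_coord 3 U HU field_X Cx); auto using valid_x.
  - apply (D_iterT i (iter_op j Dred (sigma0 k))); auto using sm_iterD, sm_sigma0.
Qed.

Lemma Tt_sigma d z : Om z -> Tred (fun y => sigma y d) z = field_t d (sigma z).
Proof.
  intros Hz; destruct d as [| |k i j]; simpl; auto.
  - apply (op_coord 3 U HU field_T Ct); auto using valid_t.
  - apply (op_coord 3 U HU field_T Cx); auto using valid_x.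
Qed.

Lemma Dx_sigma f N z : sm f -> depends_on 3 N f -> Om z ->
  Dx 3 N f (sigma z) = Dred (fun y => f (sigma y)) z.
Proof.
  intros Hf HN Hz; unfold Dred; rewrite (op_comp 3 U HU field_X f N); auto using sm_sigma.
  rewrite Dx_lsum; apply lsum_ext; intros d _; fold Dred.
  rewrite D_sigma by auto; ring.
Qed.

Lemma Dt_sigma f N z : sm f -> depends_on 3 N f -> Om z ->
  Dt 3 N f (sigma z) = Tred (fun y => f (sigma y)) z.
Proof.
  intros Hf HN Hz; unfold Tred; rewrite (op_comp 3 U HU field_T f N); auto using sm_sigma.
  rewrite Dt_lsum; apply lsum_ext; intros d _; fold Tred.
  rewrite Tt_sigma by auto; ring.
Qed.

Lemma sm_comp_sigma f : sm f -> sm (fun z => f (sigma z)).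
Proof. intros Hf; apply (sm_comp 3 U HU); auto using sm_sigma. Qed.

(** Full total derivatives along [sigma] are restricted derivatives of the pullback, and the
    pullback of e is zero. *)
Lemma sigma_consequences e N p q z : sm e -> depends_on 3 N e ->
  (forall y, Om y -> e (sigma y) = 0) -> Om z ->
  Dts 3 p (N + q) (Dxs 3 q N e) (sigma z) = 0.
Proof.
  intros He HN E.
  assert (Ex : forall y, Om y -> Dxs 3 q N e (sigma y) = 0).
  { clear z; induction q as [|q IH]; simpl; auto; intros y Hy.
    destruct (Dxs_regular 3 U HU N q e HN He) as [D1 S1].
    rewrite Dx_sigma by auto; apply D_zero; auto using sm_comp_sigma. }
  destruct (Dxs_regular 3 U HU N q e HN He) as [D1 S1].
  revert z; induction p as [|p IH]; simpl; auto; intros z Hz.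
  destruct (Dts_regular 3 U HU (N + q) p _ D1 S1) as [D2 S2].
  rewrite Dt_sigma by auto; apply Tt_zero; auto using sm_comp_sigma.
Qed.

Lemma Rd_iter j i f n : sm f -> Rd n f ->
  exists q, Rd q (iter_op i Tred (iter_op j Dred f)).
Proof.
  intros Hf HR.
  assert (H : exists q, Rd q (iter_op j Dred f)).
  { induction j as [|j [q IH]]; simpl; eauto using Rd_D, sm_iterD. }
  destruct H as [q Hq].
  induction i as [|i [r IH]]; simpl; eauto.
  exists (r + 2)%nat; apply Rd_Tt; auto using sm_iterT, sm_iterD.
Qed.

Lemma Rd_sigma d : exists q, Rd q (fun z => sigma z d).
Proof.
  destruct d as [| |k i j]; simpl.
  - exists 0%nat; intros z w _ _ E; apply E, rd_t.
  - exists 0%nat; intros z w _ _ E; apply E, rd_x.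
  - apply (Rd_iter j i (sigma0 k) 2); auto using sm_sigma0.
    intros z w _ _ E; destruct k as [|[|[|k]]]; cbn [sigma0];
      rewrite ?(E (jc 0)), ?(E (jc 1)), ?(E (jc 2)), ?(E Cx); auto using rd_x;
      apply rd_s; lia.
Qed.

Lemma Rd_comp_sigma f : sm f -> exists q, Rd q (fun z => f (sigma z)).
Proof.
  intros [N [HN _]].
  assert (H : forall l : list coord, exists q, forall d, In d l -> Rd q (fun z => sigma z d)).
  { induction l as [|d l [q Hq]]; [exists 0%nat; simpl; tauto|].
    destruct (Rd_sigma d) as [r Hr]; exists (max q r); intros e [<-|He].
    - apply (Rd_mono r); auto; lia.
    - apply (Rd_mono q); auto; lia. }
  destruct (H (coords 3 N)) as [q Hq]; exists q; intros z w Hz Hw E.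
  apply HN; intros d Hd; apply (Hq d); auto; now apply relevant_coords.
Qed.

(** * The common system and its differential consequences *)

Definition gsys : list (jet -> R) :=
  [ (fun z => z (Cu 1 0 1) - z (Cu 0 0 0));
    (fun z => z (Cu 1 1 0) - (A (z (Cu 0 0 0)) * z (Cu 0 0 1) + b * B (z (Cu 0 0 0))));
    (fun z => z (Cu 2 0 1) - phi (z Cx) * z (Cu 0 0 0));
    (fun z => z (Cu 2 1 0) - (phi (z Cx) * A (z (Cu 0 0 0)) * z (Cu 0 0 1)
                              + c * B (z (Cu 0 0 0)))) ].

Lemma gsys_solved e : In e gsys -> exists k i j g, e = (fun z => z (Cu k i j) - g z) /\
  relevant 3 1 (Cu k i j) /\ sm g /\ depends_on 3 1 g.
Proof.
  assert (Hu1 : sm (fun z => z (Cu 0 0 1))) by apply (sm_s 3).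
  assert (HA' := sm_A); assert (HB' := sm_B); assert (Hphi' := sm_phi).
  cbn [jc] in HA', HB'.
  intros [<-|[<-|[<-|[<-|[]]]]].
  - exists 1%nat, 0%nat, 1%nat, (fun z => z (Cu 0 0 0)); repeat split; simpl; try lia.
    + apply (sm_s 2).
    + intros z w E; apply E; simpl; lia.
  - exists 1%nat, 1%nat, 0%nat,
      (fun z => A (z (Cu 0 0 0)) * z (Cu 0 0 1) + b * B (z (Cu 0 0 0)));
      repeat split; simpl; try lia.
    + apply sm_P.
    + intros z w E; now rewrite (E (Cu 0 0 0)), (E (Cu 0 0 1)) by (simpl; lia).
  - exists 2%nat, 0%nat, 1%nat, (fun z => phi (z Cx) * z (Cu 0 0 0));
      repeat split; simpl; try lia.
    + apply (sm_mult 3 U HU); auto; apply (sm_s 2).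
    + intros z w E; now rewrite (E (Cu 0 0 0)), (E Cx) by (simpl; auto; lia).
  - exists 2%nat, 1%nat, 0%nat, (fun z => phi (z Cx) * A (z (Cu 0 0 0)) * z (Cu 0 0 1)
                              + c * B (z (Cu 0 0 0)));
      repeat split; simpl; try lia.
    + apply (sm_plus 3 U HU); [|now apply (sm_scal 3 U HU)].
      apply (sm_mult 3 U HU (fun z => phi (z Cx) * A (z (Cu 0 0 0)))); auto.
      now apply (sm_mult 3 U HU).
    + intros z w E; now rewrite (E (Cu 0 0 0)), (E (Cu 0 0 1)), (E Cx) by (simpl; auto; lia).
Qed.

Lemma gsys_regular e : In e gsys -> sm e /\ depends_on 3 1 e.
Proof.
  intros He; destruct (gsys_solved e He) as [k [i [j [g [-> [Hr [Hg Dg]]]]]]]; split.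
  - apply (sm_minus 3 U HU (fun z => z (Cu k i j))); auto.
    apply (sm_coord 3 U HU); eexists; eauto.
  - intros z w E; now rewrite (E _ Hr), (Dg z w E).
Qed.

Lemma D_sigma2 z : Om z ->
  Dred (sigma0 2) z = phi (z Cx) * z (jc 2).
Proof.
  intros Hz; cbn [sigma0]; unfold Dred.
  rewrite (op_plus 3 U HU), (op_mult 3 U HU) by
    (auto using sm_s, sm_phi; apply (sm_mult 3 U HU); auto using sm_s, sm_phi).
  fold Dred; rewrite D_phi, !D_s, !X_s by auto; cbn [gam]; ring.
Qed.

Lemma Tt_sigma2 z : Om z ->
  Tred (sigma0 2) z = phi (z Cx) * A (z (jc 2)) * z (jc 3) + c * B (z (jc 2)).
Proof.
  intros Hz; cbn [sigma0]; unfold Tred.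
  rewrite (op_plus 3 U HU), (op_mult 3 U HU) by
    (auto using sm_s, sm_phi; apply (sm_mult 3 U HU); auto using sm_s, sm_phi).
  fold Tred; rewrite Tt_phi, !Tt_s by auto.
  change (field_T (jc 0) z) with (- (phi1 (z Cx) * B (z (jc 2)))).
  change (field_T (jc 1) z) with (flux_P z).
  unfold flux_P; rewrite Hphi1; ring.
Qed.

Lemma sigma_gsys e z : In e gsys -> Om z -> e (sigma z) = 0.
Proof.
  intros He Hz.
  assert (E01 : sigma z (Cu 0 0 1) = z (jc 3)).
  { change (Dred (fun y => y (jc 2)) z = z (jc 3)); rewrite D_s, X_s by auto; cbn [gam]; ring. }
  assert (E11 : sigma z (Cu 1 0 1) = z (jc 2)).
  { change (Dred (fun y => y (jc 1)) z = z (jc 2)); rewrite D_s, X_s by auto; cbn [gam]; ring. }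
  assert (E12 : sigma z (Cu 1 1 0) = flux_P z).
  { change (Tred (fun y => y (jc 1)) z = flux_P z); now rewrite Tt_s. }
  assert (E21 := D_sigma2 z Hz); change (Dred (sigma0 2) z) with (sigma z (Cu 2 0 1)) in E21.
  assert (E22 := Tt_sigma2 z Hz); change (Tred (sigma0 2) z) with (sigma z (Cu 2 1 0)) in E22.
  destruct He as [<-|[<-|[<-|[<-|[]]]]]; rewrite ?E01, ?E11, ?E12, ?E21, ?E22;
    change (sigma z (Cu 0 0 0)) with (z (jc 2)); change (sigma z Cx) with (z Cx);
    unfold flux_P; ring.
Qed.

Lemma sigma_sol z : Om z -> sol_set 3 Om gsys 1 (sigma z).
Proof.
  intros Hz; split; [exact Hz|]; intros e p q He.
  destruct (gsys_regular e He) as [H1 H2].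
  apply sigma_consequences; auto; intros y Hy; now apply sigma_gsys.
Qed.

(** The right-hand sides of the solved equations involve only x and x-derivatives of u. After p
    differentiations in t they involve x and u_{i,j} with i <= p, never the potentials, which is
    what the induction in [sol_coordinates] needs. *)
Definition upto (p : nat) (d : coord) : Prop :=
  match d with Ct => False | Cx => True | Cu k i j => k = 0%nat /\ (i <= p)%nat end.

Lemma dep_upto_Dxs q N p g : dep (upto p) g -> dep (upto p) (Dxs 3 q N g).
Proof.
  intros Hg; induction q as [|q IH]; simpl; auto.
  apply (dep_Dx 3 (upto p)); auto; intros [| |k i j] H z w E; auto.
  apply (E (Cu k i (S j))); exact H.
Qed.

Lemma dep_upto_Dts p N g : dep (upto 0) g -> dep (upto p) (Dts 3 p N g).
Proof.
  intros Hg; induction p as [|p IH]; simpl; auto.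
  apply (dep_Dt 3 (upto p)); auto.
  - intros [| |k i j]; simpl; auto; lia.
  - intros [| |k i j] H z w E; auto.
    apply (E (Cu k (S i) j)); simpl in *; lia.
Qed.

Lemma sol_agree k i j g p q y y' : In (fun z => z (Cu k i j) - g z) gsys ->
  relevant 3 1 (Cu k i j) -> sm g -> depends_on 3 1 g -> dep (upto 0) g ->
  sol_set 3 Om gsys 1 y -> sol_set 3 Om gsys 1 y' ->
  (forall d, upto p d -> y d = y' d) ->
  y (Cu k (i + p) (j + q)) = y' (Cu k (i + p) (j + q)).
Proof.
  intros He Hr Hg Dg Hdep [HO Hy] [HO' Hy'] E.
  specialize (Hy _ p q He); specialize (Hy' _ p q He).
  rewrite (Dts_Dxs_solved 3 U HU) in Hy, Hy' by auto.
  assert (H := dep_upto_Dts p (1 + q) _ (dep_upto_Dxs q 1 0 g Hdep) y y' E).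
  lra.
Qed.

(* Induction on the number p of t-derivatives: the second and fourth equations
   express v^k_{p+1,q} through u_{i,j} with i <= p, and v^1_x = u then gives u_{p+1,q}. *)
Lemma sol_coordinates y y' :
  sol_set 3 Om gsys 1 y -> sol_set 3 Om gsys 1 y' ->
  y Cx = y' Cx -> (forall k, y (jc k) = y' (jc k)) ->
  forall k i j, (k < 3)%nat -> y (Cu k i j) = y' (Cu k i j).
Proof.
  intros Hy Hy' Ex Es.
  assert (S0 : sm (fun z => z (Cu 0 0 0))) by apply (sm_s 2).
  assert (E1 : forall p q, y (Cu 1 p (S q)) - y (Cu 0 p q) = 0 /\
                           y' (Cu 1 p (S q)) - y' (Cu 0 p q) = 0).
  { intros p q; destruct Hy as [HO Hy], Hy' as [HO' Hy'].
    assert (He : In (fun z : jet => z (Cu 1 0 1) - z (Cu 0 0 0)) gsys) by (left; reflexivity).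
    assert (D0 : depends_on 3 1 (fun z => z (Cu 0 0 0)))
      by (intros z w E; apply E; simpl; lia).
    assert (R1 : relevant 3 1 (Cu 1 0 1)) by (simpl; lia).
    assert (G : forall z, Om z ->
      Dts 3 p (1 + q) (Dxs 3 q 1 (fun z => z (Cu 1 0 1) - z (Cu 0 0 0))) z =
      z (Cu 1 p (S q)) - z (Cu 0 p q)).
    { intros z Hz; rewrite (Dts_Dxs_solved 3 U HU) by auto; simpl Nat.add.
      replace (Dxs 3 q 1 (fun z : jet => z (Cu 0 0 0)))
        with (fun z : jet => z (Cu 0 0 q))
        by (extensionality x; rewrite Dxs_coord by (simpl; lia); reflexivity).
      rewrite Dts_coord by (simpl; lia); reflexivity. }
    split; [rewrite <- G by auto; now apply Hy|rewrite <- G by auto; now apply Hy']. }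
  assert (Hv1 : forall p q, (forall d, upto p d -> y d = y' d) ->
            y (Cu 1 (S p) q) = y' (Cu 1 (S p) q)).
  { intros p q E.
    destruct (gsys_solved (fun z => z (Cu 1 1 0) -
      (A (z (Cu 0 0 0)) * z (Cu 0 0 1) + b * B (z (Cu 0 0 0))))) as [? _];
      [right; left; reflexivity|].
    apply (sol_agree 1 1 0 flux_P p q); auto; [right; left; reflexivity|simpl; lia|
      apply sm_P| |].
    - intros z w F; unfold flux_P; now rewrite (F (jc 2)), (F (jc 3)) by (simpl; lia).
    - intros z w F; unfold flux_P; now rewrite (F (jc 2)), (F (jc 3)) by (simpl; lia). }
  assert (Hup : forall p d, upto p d -> y d = y' d).
  { induction p as [|p IH]; intros [| |k i j]; simpl; try tauto; intros [-> Hi].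
    - replace i with 0%nat by lia; apply (Es (S (S j))).
    - destruct (Nat.le_gt_cases i p) as [H|H]; [apply IH; simpl; auto|].
      replace i with (S p) by lia.
      destruct (E1 (S p) j) as [F F'].
      assert (F1 := Hv1 p (S j) IH); lra. }
  assert (HA' := sm_A); assert (HB' := sm_B); assert (Hphi' := sm_phi).
  cbn [jc] in HA', HB'.
  intros [|[|[|k]]] i j Hk; [| | |lia].
  - apply (Hup i); simpl; auto.
  - destruct i as [|i]; [destruct j as [|j]|apply Hv1, Hup].
    + apply (Es 1%nat).
    + destruct (E1 0%nat j) as [F F'].
      assert (F0 : y (Cu 0 0 j) = y' (Cu 0 0 j)) by apply (Es (S (S j))); lra.
  - destruct i as [|i]; [destruct j as [|j]|].
    + apply (Es 0%nat).
    + apply (sol_agree 2 0 1 (fun z => phi (z Cx) * z (Cu 0 0 0)) 0 j); auto.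
      * right; right; left; reflexivity.
      * simpl; lia.
      * now apply (sm_mult 3 U HU).
      * intros z w F; now rewrite (F Cx), (F (Cu 0 0 0)) by (simpl; auto; lia).
      * intros z w F; now rewrite (F Cx), (F (Cu 0 0 0)) by (simpl; auto; lia).
      * exact (Hup 0%nat).
    + apply (sol_agree 2 1 0 (fun z => phi (z Cx) * A (z (Cu 0 0 0)) * z (Cu 0 0 1)
                              + c * B (z (Cu 0 0 0))) i j); auto.
      * right; right; right; left; reflexivity.
      * simpl; lia.
      * apply (sm_plus 3 U HU); [|now apply (sm_scal 3 U HU)].
        apply (sm_mult 3 U HU (fun z => phi (z Cx) * A (z (Cu 0 0 0)))); auto;
          [now apply (sm_mult 3 U HU)|apply (sm_s 3)].
      * intros z w F; now rewrite (F Cx), (F (Cu 0 0 0)), (F (Cu 0 0 1)) by (simpl; auto; lia).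
      * intros z w F; now rewrite (F Cx), (F (Cu 0 0 0)), (F (Cu 0 0 1)) by (simpl; auto; lia).
      * exact (Hup i).
Qed.

(** * Inverting the parametrization and descending to the full jet space *)

Lemma Om_tau z : Om z -> Om (tau z).
Proof. intros Hz; apply Om_upd; auto; discriminate. Qed.

Lemma tau_other z d : d <> jc 0 -> tau z d = z d.
Proof. apply upd_other. Qed.

Lemma sm_tau d : valid 3 d -> sm (fun z => tau z d).
Proof.
  intros Hd; unfold tau, upd; destruct (coord_eq_dec (jc 0) d).
  - apply (sm_minus 3 U HU); auto using sm_s.
    apply (sm_mult 3 U HU); auto using sm_phi, sm_s.
  - now apply (sm_coord 3 U HU).
Qed.

Lemma sigma_u z j : Om z -> sigma z (Cu 0 0 j) = z (jc (S (S j))).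
Proof.
  change (sigma z (Cu 0 0 j)) with (iter_op j Dred (sigma0 0) z).
  revert z; induction j as [|j IH]; intros z Hz; [reflexivity|].
  cbn [iter_op]; rewrite (D_ext _ (fun y => y (jc (S (S j))))); auto.
  - rewrite D_s, X_s by auto; cbn [gam]; ring.
  - apply sm_iterD, sm_sigma0.
  - apply sm_s.
Qed.

(** Both jets solve the system and share x, v^1, v^2 and all x-derivatives of u, so
    [sol_coordinates] identifies all other derivatives of the three unknowns. *)
Lemma sigma_tau y d : sol_set 3 Om gsys 1 y -> valid 3 d -> sigma (tau y) d = y d.
Proof.
  intros Hy Hd; assert (HO : Om (tau y)) by (apply Om_tau, Hy).
  assert (E2 : sigma (tau y) (jc 0) = y (jc 0)).
  { change (tau y (jc 0) + phi (tau y Cx) * tau y (jc 1) = y (jc 0)).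
    rewrite (tau_other y Cx), (tau_other y (jc 1)) by discriminate.
    unfold tau; rewrite upd_same; ring. }
  destruct d as [| |k i j].
  - now apply tau_other.
  - now apply tau_other.
  - apply sol_coordinates; auto using sigma_sol.
    + intros [|[|n]]; auto.
      * change (jc (S (S n))) with (Cu 0 0 n); rewrite sigma_u by auto.
        now apply tau_other.
    + destruct Hd as [N [Hk _]]; exact Hk.
Qed.

Lemma tau_sigma z n : Om z -> forall d, rd n d -> tau (sigma z) d = z d.
Proof.
  intros Hz d [->|[->|[k [_ ->]]]]; [reflexivity..|].
  destruct k as [|[|k]].
  - unfold tau; rewrite upd_same.
    change (z (jc 0) + phi (z Cx) * z (jc 1) - phi (z Cx) * z (jc 1) = z (jc 0)); ring.
  - rewrite tau_other by discriminate; reflexivity.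
  - rewrite tau_other by discriminate; now apply sigma_u.
Qed.

(** The pullback by [sigma] is a balance equation, for which [exactness] supplies a potential K.
    Composing K with [tau] gives H on the full jet space, and the vanishing parts are defined as the
    remainders F - D_x H and G + D_t H. *)
Lemma gsys_trivial F G :
  conservation_law 3 Om gsys 1 F G -> trivial_cl 3 Om gsys 1 F G.
Proof.
  intros [HF [HG [N [DF [DG E]]]]].
  destruct (Rd_comp_sigma F HF) as [n HRF]; destruct (Rd_comp_sigma G HG) as [p HRG].
  assert (HE : balance (fun z => F (sigma z)) (fun z => G (sigma z))).
  { intros z Hz; rewrite <- (Dt_sigma F N), <- (Dx_sigma G N) by auto.
    now apply E, sigma_sol. }
  destruct (exactness n _ _ p (sm_comp_sigma F HF) (sm_comp_sigma G HG) HE HRF HRG)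
    as [K [HK [[q HRK] EK]]].
  set (H := fun z => K (tau z)).
  assert (HH : sm H).
  { apply (sm_comp 3 U HU K tau); auto using Om_tau, sm_tau. }
  assert (HHs : forall z, Om z -> H (sigma z) = K z).
  { intros z Hz; apply HRK; auto using Om_tau, Om_sigma.
    now apply tau_sigma. }
  destruct HH as [M [DH SH]]; assert (HH : sm H) by (exists M; auto).
  exists M, (fun z => F z - Dx 3 M H z), (fun z => G z + Dt 3 M H z), H.
  assert (S1 := sm_Dx 3 U HU M H HH); assert (S2 := sm_Dt 3 U HU M H HH).
  assert (S3 : sm (fun z => F z - Dx 3 M H z)) by now apply (sm_minus 3 U HU).
  assert (S4 : sm (fun z => G z + Dt 3 M H z)) by now apply (sm_plus 3 U HU).
  do 4 (split; auto); split.
  - intros y Hy.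
    (* At a solution jet every differential function can be evaluated through [sigma], where D_x H
       and D_t H become D K and T K. *)
    assert (Hf : forall f, sm f -> f y = f (sigma (tau y))).
    { intros f [L [Df _]]; apply Df; intros d Hd; symmetry.
      apply sigma_tau; auto; exists L; exact Hd. }
    assert (HO : Om (tau y)) by (apply Om_tau, Hy).
    destruct (EK (tau y) HO) as [E1 E2].
    rewrite (Hf _ S3), (Hf _ S4), Dx_sigma, Dt_sigma by auto.
    rewrite (D_ext _ K), (Tt_ext _ K), E1, E2 by auto using sm_comp_sigma; split; ring.
  - intros z Hz; split; ring.
Qed.

End Core.

Theorem theorem10 (U : R -> Prop) (A B : R -> R) :
  is_open_interval U ->
  (forall (n : nat) (y : R), U y -> ex_derive_n A n y) ->
  (forall y, U y -> A y <> 0) ->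
  ~ (exists a, forall y, U y -> A y = a) ->
  ~ (exists a b, forall y, U y -> y + b <> 0 /\ A y = a / (y + b) ^ 2) ->
  (forall y, U y -> is_derive B y (A y)) ->
  (forall F G : jet -> R,
     conservation_law 3 (u_dom U) (sys1 A B) 1 F G ->
     trivial_cl 3 (u_dom U) (sys1 A B) 1 F G) /\
  (forall eps : R, (eps = 0 \/ eps = 1 \/ eps = -1) ->
   forall F G : jet -> R,
     conservation_law 3 (u_dom U) (sys2 A B eps) 1 F G ->
     trivial_cl 3 (u_dom U) (sys2 A B eps) 1 F G).
Proof.
  intros HU HA HA0 HA1 HA2 HB; destruct (proj1 HU) as [u0 Hu0]; split.
  (* The instance phi = x, b = 0, c = -1, with phi' = 1. *)
  - replace (sys1 A B) with (gsys A B (fun x => x) 0 (-1)).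
    + assert (Hd : forall x : R, is_derive (fun x => x) x 1)
        by (intros x; apply @is_derive_id).
      assert (Hphi : forall x : R, 1 = 0 * x - -1) by (intros; ring).
      assert (H0 : R -> 1 <> 0) by (intros; lra).
      intros F G; exact (gsys_trivial U A B (fun x => x) (fun _ => 1) 0 (-1) u0
        HU HA HA0 HA1 HA2 HB Hd Hphi H0 Hu0 F G).
    + unfold gsys, sys1; repeat (f_equal; try (extensionality z; ring)).
  - intros eps _.
    (* The instance phi = e^x + eps, b = 1, c = eps, with phi' = e^x = phi - eps. *)
    replace (sys2 A B eps) with (gsys A B (fun x => exp x + eps) 1 eps).
    + assert (Hd : forall x : R, is_derive (fun x => exp x + eps) x (exp x))
        by (intros x; auto_derive; auto; ring).
      assert (Hphi : forall x, exp x = 1 * (exp x + eps) - eps) by (intros; ring).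
      assert (H0 : forall x, exp x <> 0) by (intros; apply Rgt_not_eq, exp_pos).
      intros F G; exact (gsys_trivial U A B (fun x => exp x + eps) exp 1 eps u0
        HU HA HA0 HA1 HA2 HB Hd Hphi H0 Hu0 F G).
    + unfold gsys, sys2; repeat (f_equal; try (extensionality z; ring)).
Qed.
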